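(* For each horizon $\epsilon>0$ let $u^\epsilon$ be the solution of the peridynamics equation $\partial^2_{tt}u^\epsilon=F^\epsilon(u^\epsilon)+b$ on $D\times[0,t_F]$ with $u^\epsilon=0$ on $\partial D$, $u^\epsilon(\cdot,0)=u_0$, $\partial_tu^\epsilon(\cdot,0)=v_0$, with $u^\epsilon,\partial_tu^\epsilon\in C^2([0,t_F];H^2(D)\cap H^1_0(D))$, and assume $\sup_{\epsilon>0}\|u^\epsilon\|_\infty<\infty$. Let $u^0\in C([0,t_F];L^2(D))$ be a limit of a subsequence of $\{u^{\epsilon}\}$ as $\epsilon\to0$, strongly in $C([0,t_F];L^2(D))$. For a horizon $\epsilon_n$, time step $\Delta t_n$ and mesh size $h_n$, let $(u^{\epsilon_n})^{k_n}_{h_n}$ be the Clément nodal finite element approximation of $u^{\epsilon_n}$ at time $t^{k_n}=k\Delta t_n$, with zero numerical error in the initial values, and extend it to all times by $(u^{\epsilon_n})^{k_n}_{h_n}(t):=(u^{\epsilon_n})^{k_n}_{h_n}$ for $t\in((k-1)\Delta t_n,k\Delta t_n]$. Then there are sequences $\Delta t_n\to0$, $h_n\to0$ and $\epsilon_n\to0$, $n=1,2,\dots$, such that $$\lim_{n\to\infty}\max_{t\in[0,t_F]}\big\|(u^{\epsilon_n})^{k_n}_{h_n}(t)-u^0(t)\big\|_{L^2(D)}=0 .$$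
   Context: Domain and norms. $D\subset\mathbb{R}^d$, $d\in\{2,3\}$, is a bounded $C^1$ domain; $t_F>0$ is the final time. $\|\cdot\|$ and $(\cdot,\cdot)$ are the $L^2(D)$ norm and inner product, $\|\cdot\|_s$ the $H^s(D)$ norm, $\|\cdot\|_\infty$ the $L^\infty$ norm; all functions are $\mathbb{R}^d$-valued. The data, independent of $\epsilon$, satisfy $u_0,v_0\in H^2(D)\cap H^1_0(D)$ and $b\in C^2([0,t_F];H^2(D)\cap H^1_0(D))$. Peridynamic (RNP) force with horizon $\epsilon$. $H_\epsilon(x)=\{y\in\mathbb{R}^d:|y-x|<\epsilon\}$, $\mathrm w_d=|H_1(0)|$ is the volume of the unit ball, and $S(y,x;u)=\frac{u(y)-u(x)}{|y-x|}\cdot\frac{y-x}{|y-x|}$. Then $$F^\epsilon(u)(x)=\frac{4}{\mathrm w_d\,\epsilon^{d+1}}\int_{H_\epsilon(x)\cap D}\omega(x)\omega(y)\,J^\epsilon(|y-x|)\,\psi'\big(|y-x|S(y,x;u)^2\big)\,S(y,x;u)\,\frac{y-x}{|y-x|}\,dy .$$ Here $J^\epsilon(r)=J(r/\epsilon)$ with $J\ge0$ the influence function satisfying $\int_{H_1(0)}J(|\xi|)/|\xi|\,d\xi<\infty$, $\psi:\mathbb{R}^+\to\mathbb{R}$ is smooth, positive, concave with bounded derivatives up to order 4, and $\omega\in C^2(D)$, $\omega:D\to[0,1]$, equals $1$ at points at distance $>\epsilon$ from $\partial D$ and decays smoothly to $0$ at $\partial D$. Known facts: $F^\epsilon$ is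 Lipschitz on $L^2(D)$ with constant $L_1/\epsilon^2$, and $\|F^\epsilon(u)\|_2\le\epsilon^{-5/2}(L_2\|u\|_2+L_3\|u\|_2^2)$ on $H^2(D)$, with $L_1,L_2,L_3$ depending only on $J,\psi$. Limit $u^0$ (known facts). Under the uniform $L^\infty$ bound there is a sequence of horizons tending to zero along which $u^\epsilon$ converges strongly in $C([0,t_F];L^2(D))$ to a limit $u^0$, with $u^0(t)\in SBD$ (special functions of bounded deformation) for every $t$; moreover there is a constant $K$ independent of $\epsilon$ with $\|u^\epsilon(t)-u^\epsilon(s)\|\le K|t-s|$ for $s,t\in[0,t_F]$. Finite elements. For each $h$, $\mathcal T_h$ is a conforming, shape regular triangulation of $D$ by triangles ($d=2$) or tetrahedra ($d=3$) of mesh size $h$, with nodes $x_i$ and nodal basis functions $\phi_i$. $V_h\subset H^1_0(D)$ is the space of continuous piecewise linear functions on $\mathcal T_h$ lying in $H^1_0(D)$. $\mathcal I_h$ is continuous piecewise linear nodal interpolation (with $\|u-\mathcal I_h(u)\|\le c_3h^2\|u\|_2$, $c_3$ independent of $h$) and $r_h$ the $L^2(D)$-orthogonal projection onto $V_h$. Clément interpolation. For a node $i$, $S_i$ is the set of elements having $i$ as a vertex, and $P_i$ is the $L^2(S_i)$-projection onto the continuous piecewise linear functions on $S_i$. For $w\in L^2(D)$, $\mathcal I^C_h(w)|_T=\sum_{i\in N_T}P_i(w)(x_i)\,\phi_i$ on each element $T$, where $N_T$ is the set of vertices of $T$. There is $C$ independent of $h$ with $\|w-\mathcal I_h^C(w)\|_t\le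 Ch^{s-t}\|w\|_s$ for $0\le t\le s\le2$, $t\le1$, and $\|\mathcal I_h^C(w)\|\le C\|w\|$. Clément nodal finite element approximation. Given $\epsilon,h,\Delta t$ and $t^k=k\Delta t$, it is the sequence $(u_h^k,v_h^k)\in V_h\times V_h$ with, for all $k\ge0$ and $\tilde u\in V_h$, $$\Big(\frac{u_h^{k+1}-u_h^k}{\Delta t},\tilde u\Big)=(v_h^{k+1},\tilde u),\qquad\Big(\frac{v_h^{k+1}-v_h^k}{\Delta t},\tilde u\Big)=\big(\mathcal I_h^C(F^\epsilon(u_h^k)),\tilde u\big)+\big(\mathcal I_h(b(\cdot,t^k)),\tilde u\big),$$ and zero numerical error in the initial values means $u_h^0=r_h(u_0)$ and $v_h^0=r_h(v_0)$. The approximation of $u^\epsilon(t^k)$ is $(u^\epsilon)^k_h:=u^k_h$. *)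

(* Defs.v *)
From HB Require Import structures.
From mathcomp Require Import all_boot all_order all_algebra.
From mathcomp Require Import all_classical all_reals all_analysis.

Set Implicit Arguments.
Unset Strict Implicit.
Unset Printing Implicit Defensive.
Import Order.TTheory GRing.Theory Num.Theory.
Import numFieldNormedType.Exports.
Local Open Scope classical_set_scope.
Local Open Scope ring_scope.

(* The sigma-algebra on R^n generated by the coordinates, that is, the Borel
   sigma-algebra. *)
Definition rV_display : measure_display.
Proof. exact: default_measure_display. Qed.

Section measurable_rV.
Context {R : realType} (n : nat).

Let coord (i : 'I_n) (x : 'rV[R]_n) : R := x ord0 i.

Let rV_set0 : g_sigma_preimage coord set0.
Proof. exact: sigma_algebra0. Qed.

Let rV_setC A : g_sigma_preimage coord A -> g_sigma_preimage coord (~` A).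
Proof. exact: sigma_algebraC. Qed.

Let rV_bigcup (F : (set 'rV[R]_n)^nat) :
  (forall i, g_sigma_preimage coord (F i)) ->
  g_sigma_preimage coord (\bigcup_i F i).
Proof. exact: sigma_algebra_bigcup. Qed.

HB.instance Definition _ := @isMeasurable.Build rV_display
  'rV[R]_n (g_sigma_preimage coord) rV_set0 rV_setC rV_bigcup.

Lemma measurable_coord (i : 'I_n) :
  measurable_fun [set: 'rV[R]_n] (fun x => x ord0 i).
Proof.
move=> _ Y mY; rewrite setTI; apply: sub_sigma_algebra => /=.
rewrite -bigcup_seq/=; exists i => /=; first by rewrite mem_index_enum.
by exists Y => //; rewrite setTI.
Qed.

Lemma measurable_fun_rV (d : measure_display) (T : measurableType d) (f : T -> 'rV[R]_n) :
  (forall i, measurable_fun [set: T] (fun x => f x ord0 i)) ->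
  measurable_fun [set: T] f.
Proof.
move=> mf; suff h : g_sigma_preimage coord `<=` [set A | measurable (f @^-1` A)].
  by move=> _ A mA; rewrite setTI; exact: h.
apply: smallest_sub => /=.
  split => /=; first by rewrite preimage_set0.
    by move=> A mA; rewrite setTD preimage_setC; exact: measurableC.
  by move=> F mF; rewrite preimage_bigcup; exact: bigcup_measurable.
rewrite -bigcup_seq => A [i _ [B mB <-]] /=.
by rewrite setTI -comp_preimage -[X in measurable X]setTI; exact: mf.
Qed.

End measurable_rV.

Section lebesgue_rV.
Context {R : realType}.

Definition cons_rV n (p : measurableTypeR R * 'rV[R]_n) : 'rV[R]_n.+1 :=
  \row_i (if unlift ord0 i is Some j then p.2 ord0 j else p.1).

Definition uncons_rV n (x : 'rV[R]_n.+1) : measurableTypeR R * 'rV[R]_n :=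
  (x ord0 ord0, \row_j x ord0 (lift ord0 j)).

Lemma cons_rVK n : cancel (@cons_rV n) (@uncons_rV n).
Proof.
case=> a x; rewrite /uncons_rV /cons_rV mxE unlift_none; congr (_, _).
by apply/rowP => j; rewrite !mxE liftK.
Qed.

Lemma measurable_cons_rV n : measurable_fun setT (@cons_rV n).
Proof.
apply: measurable_fun_rV => i; rewrite /cons_rV.
under eq_fun do rewrite mxE.
case: unlift => [j|]; last exact: measurable_fst.
exact: (measurableT_comp (measurable_coord j) measurable_snd).
Qed.

Lemma measurable_uncons_rV n : measurable_fun setT (@uncons_rV n).
Proof.
apply/measurable_fun_pairP; split; first exact: measurable_coord.
apply: measurable_fun_rV => j.
rewrite [X in measurable_fun _ X](_ : _ =
  (fun x : 'rV[R]_n.+1 => x ord0 (lift ord0 j))).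
  exact: measurable_coord.
by apply/funext => x /=; rewrite mxE.
Qed.

Definition lebesgue_cons n (mu : {sigma_finite_measure set 'rV[R]_n -> \bar R}) :
  set 'rV[R]_n.+1 -> \bar R :=
  pushforward (@lebesgue_measure R \x mu)%E (@cons_rV n).

Section lebesgue_cons.
Variables (n : nat) (mu : {sigma_finite_measure set 'rV[R]_n -> \bar R}).

Let preimage_cons_measurable A :
  measurable A -> measurable (@cons_rV n @^-1` A).
Proof.
by move=> mA; rewrite -[X in measurable X]setTI; exact: measurable_cons_rV.
Qed.

Let lebesgue_cons0 : lebesgue_cons mu set0 = 0%E.
Proof. by rewrite /lebesgue_cons /pushforward preimage_set0 measure0. Qed.

Let lebesgue_cons_ge0 A : (0 <= lebesgue_cons mu A)%E.
Proof. by rewrite /lebesgue_cons /pushforward. Qed.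

Let lebesgue_cons_sigma_additive : semi_sigma_additive (lebesgue_cons mu).
Proof.
move=> F mF tF mUF; rewrite /lebesgue_cons /pushforward preimage_bigcup.
apply: measure_semi_sigma_additive.
- by move=> k; exact: preimage_cons_measurable.
- apply/trivIsetP => /= i j _ _ ij; rewrite -preimage_setI.
  by move/trivIsetP : tF => /(_ _ _ _ _ ij) ->//; rewrite preimage_set0.
- by rewrite -preimage_bigcup; exact: preimage_cons_measurable.
Qed.

HB.instance Definition _ := isMeasure.Build _ _ _ (lebesgue_cons mu)
  lebesgue_cons0 lebesgue_cons_ge0 lebesgue_cons_sigma_additive.

Lemma lebesgue_cons_sigma_finite : sigma_finite setT (lebesgue_cons mu).
Proof.
have /sigma_finiteP[F [TF ndF Foo]] := sigma_finiteT (@lebesgue_measure R).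
have /sigma_finiteP[G [TG ndG Goo]] := sigma_finiteT mu.
have FG : [set: measurableTypeR R * 'rV[R]_n] = \bigcup_k (F k `*` G k).
  rewrite -setXTT TF TG predeqE => -[x y]; split.
    move=> [/= [i _ Fx] [j _ Gy]]; exists (maxn i j) => //; split.
    - by move: x Fx; exact/subsetPset/ndF/leq_maxl.
    - by move: y Gy; exact/subsetPset/ndG/leq_maxr.
  by move=> [i _ []/= ? ?]; split; exists i.
exists (fun k => @uncons_rV n @^-1` (F k `*` G k)).
  by rewrite -preimage_bigcup -FG preimage_setT.
move=> k; have [mF Fk] := Foo k; have [mG Gk] := Goo k; split.
  rewrite -[X in measurable X]setTI; apply: measurable_uncons_rV => //.
  exact: measurableX.
rewrite /lebesgue_cons /pushforward.
rewrite (_ : @cons_rV n @^-1` _ = F k `*` G k).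
  by rewrite product_measure1E// lte_mul_pinfty// ge0_fin_numE.
by rewrite -comp_preimage (_ : _ \o _ = id)//; apply/funext; exact: cons_rVK.
Qed.

HB.instance Definition _ := @Measure_isSigmaFinite.Build _ _ _ (lebesgue_cons mu)
  lebesgue_cons_sigma_finite.

End lebesgue_cons.

(* Lebesgue measure on R^n, as the n-fold product of Lebesgue measure on R. *)
Fixpoint lebesgue_rV n : {sigma_finite_measure set 'rV[R]_n -> \bar R} :=
  if n is m.+1 then lebesgue_cons (lebesgue_rV m)
  else @dirac _ 'rV[R]_0 0 R.

End lebesgue_rV.

Section euclidean.
Context {R : realType} {d : nat}.
Implicit Types (x y : 'rV[R]_d) (A : set 'rV[R]_d).

Definition dot x y : R := \sum_i x ord0 i * y ord0 i.

(* The library norm of 'rV is the maximum norm. *)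
Definition enorm x : R := Num.sqrt (dot x x).

Definition eball x (r : R) : set 'rV[R]_d := [set y | enorm (y - x) < r].

Definition bnd A : set 'rV[R]_d := closure A `\` interior A.

Definition unit_vec (i : 'I_d) : 'rV[R]_d := delta_mx ord0 i.

Definition pderivs (s : seq 'I_d) (g : 'rV[R]_d -> R) : 'rV[R]_d -> R :=
  foldr (fun i f x => 'D_(unit_vec i) f x) g s.

Definition Ck_on (k : nat) A (g : 'rV[R]_d -> R) : Prop :=
  forall s : seq 'I_d, (size s <= k)%N -> forall x, A x ->
    {for x, continuous (pderivs s g)} /\
    ((size s < k)%N -> forall i, derivable (pderivs s g) x (unit_vec i)).

End euclidean.

Section domain.
Context {R : realType} {d : nat}.
Variable D : set 'rV[R]_d.

(* Near each boundary point, D is the strict epigraph of a C^1 function in one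
   of the coordinate directions, up to orientation. *)
Definition C1_boundary : Prop :=
  forall x0, bnd D x0 ->
    exists (r : R) (j : 'I_d) (s : bool) (g : 'rV[R]_d.-1 -> R),
      [/\ 0 < r, Ck_on 1 setT g &
          forall x, eball x0 r x ->
            D x <-> g (col' j x) < (-1) ^+ s * x ord0 j].

Definition bounded_C1_domain : Prop :=
  [/\ open D, connected D, D !=set0, bounded_set D & C1_boundary].

End domain.

Section function_spaces.
Context {R : realType} {d : nat}.
Notation E := 'rV[R]_d.
Notation mu := (@lebesgue_rV R d).
Implicit Types (A D : set E) (f g w : E -> E) (phi : E -> R).

Definition inner A f g : R := \int[mu]_(x in A) dot (f x) (g x).

Definition sqnorm A f : \bar R := (\int[mu]_(x in A) (enorm (f x) ^+ 2)%:E)%E.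

Definition l2norm A f : \bar R := (sqnorm A f `^ 2^-1)%E.

Definition L2 A f : Prop :=
  (forall i, measurable_fun A (fun x => f x ord0 i)) /\ (sqnorm A f < +oo)%E.

Definition ae_eq_on D f g : Prop := {ae mu, forall x, D x -> f x = g x}.

Definition test_function D phi : Prop :=
  (forall k, Ck_on k setT phi) /\
  exists K : set E, [/\ compact K, K `<=` D & forall x, ~ K x -> phi x = 0].

Definition multi_index k := {ffun 'I_d -> 'I_k.+1}.

Definition order_mi k (a : multi_index k) : nat := \sum_i a i.

Definition partial k (a : multi_index k) phi : E -> R :=
  pderivs (flatten [seq nseq (a i) i | i <- enum 'I_d]) phi.

Definition weak_derivative D k (a : multi_index k) f g : Prop :=
  forall phi, test_function D phi -> forall j : 'I_d,
    \int[mu]_(x in D) (f x ord0 j * partial a phi x) =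
    (-1) ^+ order_mi a * \int[mu]_(x in D) (g x ord0 j * phi x).

Definition weak_derivatives D k f (G : multi_index k -> E -> E) : Prop :=
  G [ffun=> ord0] = f /\
  forall a, (order_mi a <= k)%N -> L2 D (G a) /\ weak_derivative D a f (G a).

(* The H^k(D) norm. Weak derivatives are unique up to null sets, so the infimum
   only serves to give the value +oo to functions that are not in H^k(D). *)
Definition hnorm k D f : \bar R :=
  ereal_inf [set ((\sum_(a : multi_index k | (order_mi a <= k)%N)
                     sqnorm D (G a)) `^ 2^-1)%E
            | G in [set G | weak_derivatives D f G]].

Definition Hs k D f : Prop := (hnorm k D f < +oo)%E.

Definition H10 D f : Prop :=
  Hs 1 D f /\
  forall e : R, 0 < e ->
    exists2 phi : E -> E, (forall i, test_function D (fun x => phi x ord0 i)) &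
      (hnorm 1 D (f - phi)%R < e%:E)%E.

Definition H2_H10 D f : Prop := Hs 2 D f /\ H10 D f.

End function_spaces.

(* Continuity and differentiability on [0, T] of curves of functions, with
   respect to a norm N taking values in [0, +oo]. *)
Section curves.
Context {R : realType} {d : nat}.
Notation E := 'rV[R]_d.
Variables (N : (E -> E) -> \bar R) (T : R).
Implicit Types u du : R -> E -> E.

Definition curve_continuous u : Prop :=
  forall t, `[0, T]%classic t ->
    N (u s - u t) @[s --> within `[0, T]%classic (nbhs t)] --> 0%E.

Definition curve_derivative u du : Prop :=
  forall t, `[0, T]%classic t ->
    N ((s - t)^-1 *: (u s - u t) - du t) @[s --> within `[0, T]%classic t^'] --> 0%E.

Definition C2_curve (X : (E -> E) -> Prop) u u1 u2 : Prop :=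
  [/\ forall t, `[0, T]%classic t -> [/\ X (u t), X (u1 t) & X (u2 t)],
      curve_derivative u u1, curve_derivative u1 u2 & curve_continuous u2].

End curves.

Section peridynamics.
Context {R : realType} {d : nat}.
Notation E := 'rV[R]_d.
Notation mu := (@lebesgue_rV R d).

Definition influence_function (J : R -> R) : Prop :=
  (forall r, 0 <= r -> 0 <= J r) /\
  mu.-integrable (eball (0 : E) 1) (fun xi => (J (enorm xi) / enorm xi)%:E).

(* Only the values on ]0, +oo[ matter: in the force, psi'(0) is multiplied by
   a zero strain. *)
Definition potential (psi : R -> R) : Prop :=
  [/\ forall n r, 0 < r -> derivable (derive1n n psi) r 1,
      forall r, 0 < r -> 0 < psi r,
      forall r s l, 0 < r -> 0 < s -> 0 <= l <= 1 ->
        l * psi r + (1 - l) * psi s <= psi (l * r + (1 - l) * s) &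
      exists M : R, forall n r, (1 <= n <= 4)%N -> 0 < r -> `|derive1n n psi r| <= M].

Definition cutoff (D : set E) (eps : R) (omega : E -> R) : Prop :=
  [/\ Ck_on 2 D omega,
      forall x, D x -> 0 <= omega x <= 1,
      forall x, D x -> (forall y, bnd D y -> eps < enorm (x - y)) ->
        omega x = 1 &
      forall x0, bnd D x0 -> omega x @[x --> within D (nbhs x0)] --> (0 : R)].

Definition strain (y x : E) (u : E -> E) : R :=
  dot ((enorm (y - x))^-1 *: (u y - u x)) ((enorm (y - x))^-1 *: (y - x)).

Definition unit_ball_volume : R := fine (mu (eball 0 1)).

Definition force (J psi : R -> R) (D : set E) (omega : E -> R) (eps : R)
    (u : E -> E) : E -> E := fun x =>
  (4 / (unit_ball_volume * eps ^+ d.+1)) *: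
  \row_i \int[mu]_(y in eball x eps `&` D)
    (omega x * omega y * J (enorm (y - x) / eps)
     * derive1 psi (enorm (y - x) * strain y x u ^+ 2) * strain y x u
     * ((enorm (y - x))^-1 *: (y - x)) ord0 i).

(* The condition u = 0 on the boundary is membership in H^1_0. *)
Definition peridynamic_solution (D : set E) (tF : R) (F : (E -> E) -> E -> E)
    (b : R -> E -> E) (u0 v0 : E -> E) (u : R -> E -> E) : Prop :=
  exists u1 u2 u3 : R -> E -> E,
    [/\ C2_curve (hnorm 2 D) tF (H2_H10 D) u u1 u2,
        C2_curve (hnorm 2 D) tF (H2_H10 D) u1 u2 u3,
        forall t, `[0, tF]%classic t -> ae_eq_on D (u2 t) (F (u t) + b t),
        ae_eq_on D (u 0) u0 & ae_eq_on D (u1 0) v0].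

Definition L2_lipschitz (D : set E) (F : (E -> E) -> E -> E) (L : R) : Prop :=
  forall u v, L2 D u -> L2 D v ->
    L2 D (F u) /\ (l2norm D (F u - F v)%R <= L%:E * l2norm D (u - v)%R)%E.

Definition H2_bound (D : set E) (F : (E -> E) -> E -> E) (c L L' : R) : Prop :=
  forall u, H2_H10 D u ->
    (hnorm 2 D (F u) <=
     c%:E * (L%:E * hnorm 2 D u + L'%:E * hnorm 2 D u ^+ 2))%E.

End peridynamics.

Record mesh (R : realType) (d : nat) := Mesh {
  mesh_nodes : nat;
  node : 'I_mesh_nodes -> 'rV[R]_d;
  elements : {set {set 'I_mesh_nodes}} }.

Section meshes.
Context {R : realType} {d : nat}.
Notation E := 'rV[R]_d.
Variable M : mesh R d.
Notation idx := 'I_(mesh_nodes M).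
Implicit Types (T : {set idx}) (l : idx -> R) (w : E -> E).

Definition combination l : E := \sum_i l i *: node i.

Definition weights T l : Prop :=
  [/\ forall i, 0 <= l i, forall i, i \notin T -> l i = 0 & \sum_i l i = 1].

Definition cell T : set E := [set combination l | l in weights T].

Definition affinely_independent T : Prop :=
  forall l, (forall i, i \notin T -> l i = 0) -> \sum_i l i = 0 ->
    combination l = 0 -> forall i, l i = 0.

Definition cell_diameter T : R :=
  \big[Num.max/0]_(i in T) \big[Num.max/0]_(j in T) enorm (node i - node j).

Definition mesh_size : R := \big[Num.max/0]_(T in elements M) cell_diameter T.

Definition cells (A : {set {set idx}}) : set E :=
  [set x | exists2 T, T \in A & cell T x].

(* The elements fill D up to points at distance at most mesh_size from the
   boundary: straight elements cannot fill a C^1 domain exactly. Triangulations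
   with [cells (elements M) = closure D] are the special case of no gap. *)
Definition triangulation (D : set E) : Prop :=
  [/\ forall T, T \in elements M -> #|T| = d.+1 /\ affinely_independent T,
      forall T T', T \in elements M -> T' \in elements M ->
        cell T `&` cell T' = cell (T :&: T'),
      forall i, exists2 T, T \in elements M & i \in T,
      cells (elements M) `<=` closure D &
      forall x, D x -> (forall y, bnd D y -> mesh_size < enorm (x - y)) ->
        cells (elements M) x].

Definition shape_regular (sigma : R) : Prop :=
  forall T, T \in elements M ->
    exists c, eball c (sigma * cell_diameter T) `<=` cell T.

Definition piecewise_linear (A : {set {set idx}}) w : Prop :=
  {within cells A, continuous w} /\
  forall T, T \in A -> forall l, weights T l ->
    w (combination l) = \sum_i l i *: w (node i).

(* Barycentric coordinate of node i in the element containing x, and 0 outside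
   the mesh. *)
Definition nodal_basis (i : idx) (x : E) : R :=
  xget (fun=> 0) [set l | combination l = x /\
                          exists2 T, T \in elements M & weights T l] i.

Definition Vh (D : set E) w : Prop :=
  [/\ piecewise_linear (elements M) w,
      forall x, ~ cells (elements M) x -> w x = 0 & H10 D w].

Definition is_l2_projection (V : (E -> E) -> Prop) (A : set E) w p : Prop :=
  V p /\ forall q, V q -> inner A (w - p) q = 0.

Definition l2_projection (V : (E -> E) -> Prop) (A : set E) w : E -> E :=
  xget (fun=> 0) [set p | is_l2_projection V A w p].

Definition continuous_version (D : set E) w : E -> E :=
  xget (fun=> 0) [set g | {within closure D, continuous g} /\ ae_eq_on D g w].

(* Elements of H^2(D) are interpolated through their continuous version. *)
Definition interp (D : set E) w : E -> E := fun x =>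
  \sum_i nodal_basis i x *: continuous_version D w (node i).

Definition star (i : idx) : {set {set idx}} :=
  [set T in elements M | i \in T].

(* Functions are defined on D, hence the intersection with D. *)
Definition clement_node (D : set E) (i : idx) w : E -> E :=
  l2_projection (piecewise_linear (star i)) (cells (star i) `&` D) w.

Definition clement (D : set E) w : E -> E := fun x =>
  \sum_i nodal_basis i x *: clement_node D i w (node i).

Definition interp_estimate (D : set E) (c : R) : Prop :=
  forall w, H2_H10 D w ->
    Vh D (interp D w) /\
    (l2norm D (w - interp D w)%R <= (c * mesh_size ^+ 2)%:E * hnorm 2 D w)%E.

Definition clement_estimate (D : set E) (C : R) : Prop :=
  (forall w, L2 D w -> (l2norm D (clement D w) <= C%:E * l2norm D w)%E) /\
  (forall w s, (s <= 2)%N -> Hs s D w ->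
    (l2norm (cells (elements M) `&` D) (w - clement D w)%R
     <= (C * mesh_size ^+ s)%:E * hnorm s D w)%E).

Definition clement_fe_approximation (D : set E) (tF dt : R)
    (F : (E -> E) -> E -> E) (b : R -> E -> E) (u0 v0 : E -> E)
    (uh vh : nat -> E -> E) : Prop :=
  [/\ forall k, Vh D (uh k) /\ Vh D (vh k),
      uh 0%N = l2_projection (Vh D) D u0,
      vh 0%N = l2_projection (Vh D) D v0 &
      forall k w, k%:R * dt <= tF -> Vh D w ->
        inner D (dt^-1 *: (uh k.+1 - uh k)) w = inner D (vh k.+1) w /\
        inner D (dt^-1 *: (vh k.+1 - vh k)) w =
          inner D (clement D (F (uh k))) w
          + inner D (interp D (b (k%:R * dt))) w].

End meshes.

(* The step function equal to u k on ](k - 1) dt, k dt]. *)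
Definition step_extension (R : realType) (X : Type) (dt : R) (u : nat -> X)
  (t : R) : X := u `|Num.ceil (t / dt)|%N.

(* Main.v *)
Require Import Defs.
From mathcomp Require Import all_boot all_order all_algebra.
From mathcomp Require Import all_classical all_reals all_analysis.
From mathcomp Require Import measurable_realfun ring lra.
Import Order.TTheory GRing.Theory Num.Theory.
Import numFieldNormedType.Exports.
Local Open Scope classical_set_scope.
Local Open Scope ring_scope.

Set Implicit Arguments.
Unset Strict Implicit.
Unset Printing Implicit Defensive.

(** For a fixed horizon, let P be the L2 projection onto Vh. The errors
    e_u^k = |u_h^k - P u(t^k)| and e_v^k = |v_h^k - P u'(t^k)| vanish at k = 0
    and satisfy e_u^(k+1) <= e_u^k + dt (e_v^(k+1) + O(dt)) and
    e_v^(k+1) <= e_v^k + dt (O(e_u^k) + O(h^2 + dt)). Here the Clement operator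
    is linear and L2 bounded, so that it preserves the Lipschitz continuity of
    the force, and the consistency errors come from the mean value theorem
    applied to s |-> (u(s), w). A discrete Gronwall inequality bounds the total
    error by K_eps (h^2 + dt). The constant K_eps may blow up as eps -> 0, so
    along the given sequence of horizons with u^eps -> u^0 the parameters h_n
    and dt_n are chosen after eps_n, with dt_n dividing tF, such that the
    discretization error is at most 1/(n+1). *)

(** Functions are not identified almost everywhere, and [inner] is an integral whose linearity is
    available only on [L2]; the Hilbert space argument therefore runs over a degenerate form
    restricted to a predicate. Projections are unique only up to null functions, and [l2_projection]
    is a choice that means something only once existence is proved. The Clement operator is linear
    all the same, because it reads off nodal values, and these vanish for a null piecewise linear
    function. The errors are measured against projections of the exact solution because the scheme
    is tested with [Vh] only: the residuals of the projections are orthogonal to [Vh] and drop out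
    of the difference quotients. A curve of functions has no mean value theorem, so each step is
    first tested with its own new error, which leaves a real function of time. *)

(** * Open sets and continuous functions are Borel *)

Section borel.
Context {R : realType} {n : nat}.
Implicit Types (c x : 'rV[R]_n) (r : R) (U : set 'rV[R]_n).

Lemma ball_rVE c r : 0 < r ->
  ball c r = [set x | forall i, `|c ord0 i - x ord0 i| < r].
Proof.
move=> r0; apply/seteqP; split=> x /=.
  by move=> [_ cx] i; exact: cx.
by move=> cx; split=> // i j; rewrite (ord1 i); exact: cx.
Qed.

Lemma measurable_ball_rV c r : 0 < r -> measurable (ball c r).
Proof.
move=> r0; rewrite ball_rVE//.
rewrite [X in measurable X](_ : _ = \bigcap_(i in [set: 'I_n])
    ((fun x : 'rV[R]_n => x ord0 i) @^-1` ball (c ord0 i) r)); last first.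
  by apply/seteqP; split=> x /= h i => [_|]; exact: h.
apply: fin_bigcap_measurable => [|i _]; first exact: finite_finset.
rewrite -[X in measurable X]setTI; apply: measurable_coord => //.
by apply: open_measurable; exact: ball_open.
Qed.

(** Balls of the maximum norm are boxes, hence finite intersections of coordinate preimages; an open
    set is the countable union of the boxes of rational centre and radius inside it. *)
Lemma open_measurable_rV U : open U -> measurable U.
Proof.
move=> oU.
pose B (p : 'rV[rat]_n * rat) : set 'rV[R]_n :=
  ball (map_mx ratr p.1 : 'rV[R]_n) (ratr p.2 : R).
pose F p := if `[< 0 < p.2 /\ B p `<=` U >] then B p else set0.
have -> : U = \bigcup_p F p.
  apply/seteqP; split=> [x Ux|x [p _]]; last first.
    by rewrite /F; case: asboolP => // -[_ BU] /BU.
  have /nbhs_ballP[e /= e0 xeU] : nbhs x U by exact: open_nbhs_nbhs.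
  (* With r < e/2, a box of radius r that contains x lies in the ball of radius e around x. *)
  have [r] := @rat_in_itvoo R 0 (e / 2) (divr_gt0 e0 (ltr0Sn _ _)).
  rewrite in_itv/= => /andP[r0 re].
  have /(_ _)/cid-/all_sig[q qP] : forall i, exists q : rat,
      `|ratr q - x ord0 i| < ratr r :> R.
    move=> i; have [q] := @rat_in_itvoo R (x ord0 i - ratr r) (x ord0 i + ratr r)
      ltac:(by rewrite ltrBlDr -addrA ltrDl addr_gt0).
    by rewrite in_itv/= -ltr_distl; exists q.
  exists (\row_i q i, r) => //; rewrite /F.
  have Bx : B (\row_i q i, r) x by rewrite /B ball_rVE//= => i; rewrite !mxE.
  rewrite asboolT//; split=> [|y]; first by rewrite -(ltr0q R).
  rewrite /B ball_rVE//= => By; apply: xeU.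
  rewrite ball_rVE//= => i; move: (qP i) (By i); rewrite !mxE => h1 h2.
  rewrite (splitr e) -(subrK (ratr (q i)) (x ord0 i)) -addrA.
  rewrite (le_lt_trans (ler_normD _ _))// ltrD// ?(lt_trans h2)//.
  by rewrite distrC (lt_trans h1).
apply: countable_bigcupT_measurable; first exact: countableP.
by move=> p; rewrite /F; case: asboolP => // -[p0 _]; apply: measurable_ball_rV; rewrite ltr0q.
Qed.

Lemma continuous_measurable_fun_rV (f : 'rV[R]_n -> R) :
  continuous f -> measurable_fun setT f.
Proof.
move=> /continuousP cf; apply: (measurability _ (RGenOpens.measurableE R)).
move=> _ [_ [a [b ->] <-]]; rewrite setTI; apply: open_measurable_rV.
exact/cf/interval_open.
Qed.

End borel.

(** * Lebesgue measure of balls, open sets and bounded sets *)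

Section ball_measure.
Context {R : realType}.

(** A maximum-norm ball is a cube, and [cons_rV] splits it into an interval and a cube of one
    dimension less, which matches the recursion of [lebesgue_rV]. *)
Lemma lebesgue_rV_ball n (c : 'rV[R]_n) (r : R) : 0 < r ->
  lebesgue_rV n (ball c r) = ((r *+ 2) ^+ n)%:E.
Proof.
move=> r0; elim: n c => [c|n IH c].
  by rewrite /= diracE mem_set// ball_rVE//= => -[].
rewrite /= /lebesgue_cons /pushforward.
rewrite (_ : _ @^-1` _ = ball (c ord0 ord0) r `*` ball (\row_j c ord0 (lift ord0 j)) r).
  rewrite product_measure1E; [|by apply: open_measurable; exact: ball_open|exact: measurable_ball_rV].
  rewrite IH [X in (X * _)%E](_ : _ = (r *+ 2)%:E) -?EFinM ?exprS//.
  by apply: lebesgue_measure_ball; exact: ltW.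
apply/seteqP; split=> -[a x]; rewrite !ball_rVE// /ball/= => h.
  split=> [|i]; first by have := h ord0; rewrite mxE unlift_none.
  by rewrite mxE; have := h (lift ord0 i); rewrite mxE liftK.
by case: h => h1 h2 i; rewrite mxE; case: unliftP => [j ->|->//]; have := h2 j; rewrite mxE.
Qed.

Lemma lebesgue_rV_open_gt0 n (U : set 'rV[R]_n) : open U -> U !=set0 ->
  (0 < lebesgue_rV n U)%E.
Proof.
move=> oU [x Ux]; have /nbhs_ballP[e /= e0 xeU] : nbhs x U by exact: open_nbhs_nbhs.
apply: (@lt_le_trans _ _ (lebesgue_rV n (ball x e))).
  by rewrite lebesgue_rV_ball// lte_fin exprn_gt0// mulrn_wgt0.
apply: le_measure; rewrite ?inE//; first exact: measurable_ball_rV.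
exact: open_measurable_rV.
Qed.

Lemma lebesgue_rV_bounded n (A : set 'rV[R]_n) : measurable A -> bounded_set A ->
  (lebesgue_rV n A < +oo)%E.
Proof.
move=> mA [M [_ /(_ (Num.max 0 M + 1))]].
have M1 : M < Num.max 0 M + 1 by rewrite (@le_lt_trans _ _ (Num.max 0 M)) ?le_max ?lexx ?orbT ?ltrDl.
move=> /(_ M1) AM.
have r0 : 0 < Num.max 0 M + 2 :> R by rewrite ltr_wpDl// le_max lexx.
apply: (@le_lt_trans _ _ (lebesgue_rV n (ball 0 (Num.max 0 M + 2)))); last first.
  by rewrite lebesgue_rV_ball// ltry.
apply: le_measure; rewrite ?inE//; first exact: measurable_ball_rV.
move=> x /AM/= xM; rewrite -ball_normE/= sub0r normrN (le_lt_trans xM)//.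
by rewrite ltrD2l ltr1n.
Qed.

End ball_measure.

(** Applied to residuals, it exhibits [p - (p1 - p2)] as a combination of vectors orthogonal to the
    subspace in [projectionB]. *)
Lemma addrsubK (V : zmodType) (x x' y y' z : V) :
  (x - y) - (x' - y') - (x - x' - z) = z - (y - y').
Proof.
rewrite (_ : x - y - (x' - y') = (x - x') - (y - y')).
  by move: (x - x') (y - y') => a b; rewrite opprB addrC addrA subrK.
by rewrite !opprD !opprK addrACA.
Qed.

(** * Degenerate inner products, projections and one Galerkin step *)

Section semi_inner_product.
Context {R : realType} {V : lmodType R}.

Record subspace_pred (S : V -> Prop) : Prop := SubspacePred {
  sub0 : S 0;
  subDZ : forall a x y, S x -> S y -> S (a *: x + y) }.

Lemma subZ S a x : subspace_pred S -> S x -> S (a *: x).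
Proof. by move=> hS Sx; rewrite -[_ *: _]addr0; apply: subDZ => //; exact: sub0. Qed.

Lemma subD S x y : subspace_pred S -> S x -> S y -> S (x + y).
Proof. by move=> hS Sx Sy; rewrite -[x]scale1r; exact: subDZ. Qed.

Lemma subB S x y : subspace_pred S -> S x -> S y -> S (x - y).
Proof. by move=> hS Sx Sy; rewrite addrC -scaleN1r; exact: subDZ. Qed.

(** The model is [inner A] on [L2 A]: additivity needs integrability, hence the restriction to X,
    and definiteness fails on functions that vanish almost everywhere. Symmetry holds pointwise
    under the integral, without restriction. *)
Record semi_inner (X : V -> Prop) (ip : V -> V -> R) : Prop := SemiInner {
  ip_sub : subspace_pred X;
  ip_lin : forall a x y z, X x -> X y -> X z ->
    ip (a *: x + y) z = a * ip x z + ip y z;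
  ipC : forall x y, ip x y = ip y x;
  ip_ge0 : forall x, X x -> 0 <= ip x x }.

Variables (X : V -> Prop) (ip : V -> V -> R).
Hypothesis hip : semi_inner X ip.
Let XZ a x : X x -> X (a *: x). Proof. exact: (subZ _ (ip_sub hip)). Qed.
Let XD x y : X x -> X y -> X (x + y). Proof. exact: (subD (ip_sub hip)). Qed.
Let XB x y : X x -> X y -> X (x - y). Proof. exact: (subB (ip_sub hip)). Qed.

#[local] Hint Extern 0 (X _) =>
  solve [assumption | apply: XZ; done | apply: XB; done | apply: XD; done] : core.

Lemma ipDl x y z : X x -> X y -> X z -> ip (x + y) z = ip x z + ip y z.
Proof. by move=> Xx Xy Xz; rewrite -[x]scale1r (ip_lin hip)// mul1r scale1r. Qed.

Lemma ip0l z : X z -> ip 0 z = 0.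
Proof.
move=> Xz; have X0 := sub0 (ip_sub hip).
by have := ipDl X0 X0 Xz; rewrite addr0 => /eqP; rewrite -subr_eq0 opprD addNKr oppr_eq0 => /eqP.
Qed.

Lemma ipZl a x z : X x -> X z -> ip (a *: x) z = a * ip x z.
Proof.
move=> Xx Xz; rewrite -[_ *: _]addr0 (ip_lin hip) ?ip0l ?addr0//.
exact: sub0 (ip_sub hip).
Qed.

Lemma ipBl x y z : X x -> X y -> X z -> ip (x - y) z = ip x z - ip y z.
Proof. by move=> Xx Xy Xz; rewrite addrC -scaleN1r (ip_lin hip)// mulN1r addrC. Qed.

Lemma ipDr x y z : X x -> X y -> X z -> ip z (x + y) = ip z x + ip z y.
Proof. by move=> Xx Xy Xz; rewrite (ipC hip) ipDl// !(ipC hip z). Qed.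

Lemma ipZr a x z : X x -> X z -> ip z (a *: x) = a * ip z x.
Proof. by move=> Xx Xz; rewrite (ipC hip) ipZl// (ipC hip). Qed.

Definition ipnorm x := Num.sqrt (ip x x).

Lemma ipnorm_ge0 x : 0 <= ipnorm x. Proof. exact: sqrtr_ge0. Qed.

Lemma sqr_ipnorm x : X x -> ipnorm x ^+ 2 = ip x x.
Proof. by move=> Xx; rewrite sqr_sqrtr// (ip_ge0 hip). Qed.

Lemma ip_CS x y : X x -> X y -> `|ip x y| <= ipnorm x * ipnorm y.
Proof.
move=> Xx Xy.
have q t : 0 <= ip x x + 2 * t * ip x y + t ^+ 2 * ip y y.
  have := ip_ge0 hip (XD Xx (XZ t Xy)).
  rewrite ipDl// !ipDr// !ipZl// !ipZr//.
  by rewrite (ipC hip y x) => h; apply: (le_trans h); rewrite le_eqVlt; apply/orP; left; apply/eqP; ring.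
have a0 := ip_ge0 hip Xx; have c0 := ip_ge0 hip Xy.
rewrite /ipnorm -sqrtrM// -sqrtr_sqr ler_wsqrtr//.
have [y0|y0] := eqVneq (ip y y) 0.
  suff -> : ip x y = 0 by rewrite expr0n/= mulr_ge0.
  apply/eqP/negP => /negP xy0.
  (* The polynomial is affine since [ip y y = 0], and takes the value -1 at this t. *)
  have := q (- (ip x x + 1) / (2 * ip x y)).
  rewrite y0 mulr0 addr0 (_ : 2 * _ * _ = - (ip x x + 1)); first by lra.
  by field.
have cp : 0 < ip y y by rewrite lt_def y0.
(* This t minimizes the polynomial. *)
have := q (- ip x y / ip y y).
rewrite (_ : _ + _ = (ip x x * ip y y - ip x y ^+ 2) / ip y y); last by field.
by rewrite pmulr_lge0 ?invr_gt0// subr_ge0.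
Qed.

Lemma ler_ipnormD x y : X x -> X y -> ipnorm (x + y) <= ipnorm x + ipnorm y.
Proof.
move=> Xx Xy; rewrite -(@ler_pXn2r _ 2) ?nnegrE ?addr_ge0 ?ipnorm_ge0//.
have Xxy := XD Xx Xy.
rewrite sqrrD !sqr_ipnorm// (ipDl _ _ Xxy)// !ipDr// (ipC hip y x).
have := ip_CS Xx Xy; have := ler_norm (ip x y); lra.
Qed.

Lemma ipnormZ a x : X x -> ipnorm (a *: x) = `|a| * ipnorm x.
Proof.
move=> Xx; rewrite /ipnorm ipZl// ipZr// mulrA -expr2 sqrtrM ?sqr_ge0//.
by rewrite sqrtr_sqr.
Qed.

Lemma ipnormB x y : X x -> X y -> ipnorm (x - y) = ipnorm (y - x).
Proof.
by move=> Xx Xy; rewrite -opprB -(scaleN1r (y - x)) ipnormZ// normrN1 mul1r.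
Qed.

Lemma ler_ip_ipnorm e m : X e -> 0 <= m -> ip e e <= m * ipnorm e -> ipnorm e <= m.
Proof.
move=> Xe m0; rewrite -sqr_ipnorm// expr2.
have := ipnorm_ge0 e; rewrite le_eqVlt => /predU1P[<-//|e0].
by rewrite ler_pM2r.
Qed.

(** The vector [p - (p1 - p2)] lies in S and is a combination of residuals orthogonal to S, hence is
    orthogonal to itself. For a degenerate form this is the available sense of linearity of the
    projection. *)
Lemma projectionB (S : V -> Prop) w1 w2 p1 p2 p :
  subspace_pred S -> (forall x, S x -> X x) -> X w1 -> X w2 -> S p1 -> S p2 -> S p ->
  (forall q, S q -> ip (w1 - p1) q = 0) -> (forall q, S q -> ip (w2 - p2) q = 0) ->
  (forall q, S q -> ip (w1 - w2 - p) q = 0) ->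
  ip (p - (p1 - p2)) (p - (p1 - p2)) = 0.
Proof.
move=> hS SX Xw1 Xw2 Sp1 Sp2 Sp h1 h2 h; set q := p - _.
have Sq : S q by apply: subB => //; exact: subB.
have Xq := SX _ Sq; have Xp1 := SX _ Sp1; have Xp2 := SX _ Sp2; have Xp := SX _ Sp.
rewrite {1}/q -(addrsubK w1 w2) (ipBl (XB (XB Xw1 Xp1) (XB Xw2 Xp2)) (XB (XB Xw1 Xw2) Xp) Xq).
by rewrite (ipBl (XB Xw1 Xp1) (XB Xw2 Xp2) Xq) h1// h2// h// !subr0.
Qed.

Lemma projection_best (S : V -> Prop) w p q :
  subspace_pred S -> (forall x, S x -> X x) -> X w -> S p -> S q ->
  (forall q, S q -> ip (w - p) q = 0) -> ipnorm (w - p) <= ipnorm (w - q).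
Proof.
move=> hS SX Xw Sp Sq hp; have Xp := SX _ Sp; have Xq := SX _ Sq.
apply: ler_ip_ipnorm; rewrite ?ipnorm_ge0//.
have -> : ip (w - p) (w - p) = ip (w - p) (w - q).
  rewrite -[w - p in X in ip _ X](subrKA q) (ipDr (XB Xw Xq) (XB Xq Xp))//.
  by rewrite (hp (q - p)) ?addr0//; exact: subB.
rewrite (le_trans (ler_norm _))// mulrC; exact: ip_CS.
Qed.

(* One step of the scheme, [x' = x + c g], against one step of the exact
   evolution, [y' = y + c g'], both tested with the new error [x' - p']. *)
Lemma galerkin_step (S : V -> Prop) x x' y y' p p' (c r gx gy : R) :
  subspace_pred S -> (forall x, S x -> X x) -> S x -> S x' -> X y -> X y' ->
  S p -> S p' -> (forall q, S q -> ip (y - p) q = 0) ->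
  (forall q, S q -> ip (y' - p') q = 0) -> 0 <= c ->
  ip (x' - x) (x' - p') = c * gx -> ip (y' - y) (x' - p') = c * gy ->
  0 <= r -> gx - gy <= r * ipnorm (x' - p') ->
  ipnorm (x' - p') <= ipnorm (x - p) + c * r.
Proof.
move=> hS SX Sx Sx' Xy Xy' Sp Sp' hp hp' c0 ex ey r0 hr.
have Se : S (x' - p') by exact: subB.
have [Xx Xx' Xp Xp'] : [/\ X x, X x', X p & X p'] by split; exact: SX.
have Xe := SX _ Se.
apply: ler_ip_ipnorm => //; first by rewrite addr_ge0 ?mulr_ge0 ?ipnorm_ge0.
(* Both [y - p] and [y' - p'] are orthogonal to the error, so the increment of the projections may
   be replaced by [y' - y]. *)
have -> : ip (x' - p') (x' - p') = ip (x - p) (x' - p') + c * (gx - gy).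
  have := hp _ Se; have := hp' _ Se; move: ex ey.
  by rewrite mulrBr => <- <-; rewrite !(ipBl _ _ Xe)//; lra.
rewrite mulrDl lerD//.
  by rewrite (le_trans (ler_norm _))//; apply: ip_CS => //; exact: XB.
by rewrite -mulrA ler_wpM2l.
Qed.

(* Induction on the number of functionals that determine an element of S up to
   a null element: the projection onto S is obtained from the one onto the
   kernel of the last functional and from one further direction orthogonal to
   this kernel. If that direction is null, the division by 0 gives the
   coefficient 0, which is correct by the Cauchy-Schwarz inequality. *)
Lemma exists_projection N (l : nat -> V -> R) (S : V -> Prop) :
  subspace_pred S -> (forall x, S x -> X x) ->
  (forall i a x y, S x -> S y -> l i (a *: x + y) = a * l i x + l i y) ->
  (forall x, S x -> (forall i, (i < N)%N -> l i x = 0) -> ip x x = 0) ->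
  forall w, X w -> exists2 p, S p & forall q, S q -> ip (w - p) q = 0.
Proof.
elim: N S => [|N IH] S hS SX lin hnull w Xw.
  exists 0; first exact: sub0 hS.
  move=> q Sq; rewrite subr0; apply/eqP; rewrite -normr_le0.
  rewrite (le_trans (ip_CS Xw (SX _ Sq)))// /ipnorm (hnull q Sq)//.
  by rewrite sqrtr0 mulr0.
pose S' x := S x /\ l N x = 0.
have l0 i x : S x -> l i 0 = 0.
  move=> Sx; have := lin i (-1) _ _ Sx Sx; rewrite mulN1r addNr.
  by rewrite scaleN1r addNr.
have hS' : subspace_pred S'.
  split; first by split; [exact: sub0 hS|apply: l0; exact: sub0 hS].
  move=> a x y [Sx lx] [Sy ly]; split; first exact: subDZ.
  by rewrite lin// lx ly mulr0 addr0.
have IH' : forall w, X w -> exists2 p, S' p & forall q, S' q -> ip (w - p) q = 0.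
  apply: IH => // [x [/SX]//|i a x y [Sx _] [Sy _]|x [Sx lx] h]; first exact: lin.
  by apply: hnull => // i; rewrite ltnS leq_eqVlt => /predU1P[->//|]; exact: h.
have [[g [Sg lg]]|nog] := pselect (exists g, S g /\ l N g <> 0); last first.
  have [p [Sp _] hp] := IH' w Xw; exists p => // q Sq; apply: hp; split=> //.
  by apply: contrapT => lq; apply: nog; exists q.
have [pg [Spg lpg] hpg] := IH' g (SX _ Sg).
have [pw [Spw lpw] hpw] := IH' w Xw.
set g' := g - pg.
have Sg' : S g' by exact: subB.
have lg' : l N g' = l N g by rewrite /g' addrC -scaleN1r lin// lpg mulr0 add0r.
pose c := ip w g' / ip g' g'.
exists (c *: g' + pw); first exact: subDZ.
move=> q Sq.
pose q' := q - (l N q / l N g') *: g'.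
have S'q' : S' q'.
  split; first by apply: subB => //; exact: subZ.
  rewrite /q' addrC -scaleN1r scalerA lin// mulN1r mulNr divfK ?addNr//.
  by rewrite lg'; apply/eqP.
have [Sq' _] := S'q'.
have -> : q = (l N q / l N g') *: g' + q' by rewrite /q' addrC subrK.
have Xg' := SX _ Sg'; have Xq' := SX _ Sq'; have Xpw := SX _ Spw.
have g'pw : ip pw g' = 0 by rewrite (ipC hip); exact: hpg.
rewrite opprD addrA addrAC ipDr//.
rewrite ipZr//.
rewrite ![ip (_ - _ - _) _]ipBl// !ipBl// !ipZl// (hpg q')//.
have := hpw q' S'q'; rewrite ipBl// => ->; rewrite g'pw subr0 mulr0 subrr addr0.
rewrite /c; have [g0|g0] := eqVneq (ip g' g') 0; last by rewrite divfK// subrr mulr0.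
have -> : ip w g' = 0.
  apply/eqP; rewrite -normr_le0 (le_trans (ip_CS Xw Xg'))//.
  by rewrite /ipnorm g0 sqrtr0 mulr0.
by rewrite !mul0r subrr mulr0.
Qed.

End semi_inner_product.

(** * The Euclidean inner product *)

Section dot.
Context {R : realType} {n : nat}.
Implicit Types (a : R) (x y z : 'rV[R]_n).

Lemma dotC x y : dot x y = dot y x.
Proof. by apply: eq_bigr => i _; rewrite mulrC. Qed.

Lemma dot_lin a x y z : dot (a *: x + y) z = a * dot x z + dot y z.
Proof.
rewrite /dot mulr_sumr -big_split/=; apply: eq_bigr => i _.
by rewrite !mxE mulrDl mulrA.
Qed.

Lemma dot_ge0 x : 0 <= dot x x.
Proof. by apply: sumr_ge0 => i _; rewrite -expr2 sqr_ge0. Qed.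

Lemma dot0l x : dot 0 x = 0.
Proof. by rewrite /dot big1// => i _; rewrite mxE mul0r. Qed.

Lemma dot_eq0 x : dot x x = 0 -> x = 0.
Proof.
move=> /eqP; rewrite psumr_eq0 => [|i _]; last by rewrite -expr2 sqr_ge0.
move=> /allP h; apply/rowP => i; rewrite mxE; apply/eqP.
by have := h i (mem_index_enum i); rewrite /= mulf_eq0 orbb.
Qed.

Lemma enorm_sqr x : enorm x ^+ 2 = dot x x.
Proof. by rewrite /enorm sqr_sqrtr// dot_ge0. Qed.

(** Weaker than Cauchy-Schwarz, but its right-hand side is integrable for two functions in [L2], so
    it dominates their pointwise product. *)
Lemma ler_dot x y : `|dot x y| <= dot x x + dot y y.
Proof.
have h s : s ^+ 2 = 1 -> 0 <= dot x x + dot y y + 2 * s * dot x y.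
  move=> s1; have := dot_ge0 (s *: x + y).
  rewrite dot_lin (dotC x) (dotC y) !dot_lin (dotC y x).
  rewrite (_ : s * _ + _ = s ^+ 2 * dot x x + dot y y + 2 * s * dot x y); last by ring.
  by rewrite s1 mul1r.
have h1 := h 1 (expr1n _ _); have := h (-1) ltac:(by rewrite sqrrN expr1n).
by rewrite ler_norml => h2; apply/andP; split; have := dot_ge0 x; have := dot_ge0 y; lra.
Qed.

End dot.

(** * The space L2 and its inner product *)

Section L2_space.
Context {R : realType} {d : nat}.
Notation E := 'rV[R]_d.
Notation mu := (@lebesgue_rV R d).
Implicit Types (A B D : set E) (f g w : E -> E).

Lemma measurable_dot A f g :
  (forall i, measurable_fun A (fun x => f x ord0 i)) ->
  (forall i, measurable_fun A (fun x => g x ord0 i)) ->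
  measurable_fun A (fun x => dot (f x) (g x)).
Proof. by move=> mf mg; apply: measurable_sum => i; exact: measurable_funM. Qed.

Lemma L2P A f : measurable A -> L2 A f <->
  (forall i, measurable_fun A (fun x => f x ord0 i)) /\
  mu.-integrable A (EFin \o (fun x => dot (f x) (f x))).
Proof.
move=> mA.
have sqE : (\int[mu]_(x in A) `|(EFin \o (fun x => dot (f x) (f x))) x|)%E = sqnorm A f.
  by apply: eq_integral => x _ /=; rewrite enorm_sqr ger0_norm// dot_ge0.
split=> -[mf h]; split=> //; last by rewrite -sqE; case/integrableP : h.
apply/integrableP; rewrite sqE; split=> //.
by apply/measurable_EFinP; exact: measurable_dot.
Qed.

Lemma integrable_dot A f g : measurable A -> L2 A f -> L2 A g ->
  mu.-integrable A (EFin \o (fun x => dot (f x) (g x))).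
Proof.
move=> mA /(L2P _ mA)[mf hf] /(L2P _ mA)[mg hg].
apply: le_integrable (integrableD mA hf hg) => //.
  by apply/measurable_EFinP; exact: measurable_dot.
move=> x _ /=; rewrite lee_fin (le_trans (ler_dot _ _))//.
by rewrite ger0_norm// addr_ge0// dot_ge0.
Qed.

Lemma L2_lin A a f g : measurable A -> L2 A f -> L2 A g -> L2 A (a *: f + g).
Proof.
move=> mA Lf Lg; have [mf hf] := (L2P f mA).1 Lf; have [mg hg] := (L2P g mA).1 Lg.
have mh i : measurable_fun A (fun x => (a *: f + g) x ord0 i).
  rewrite (_ : (fun _ => _) = (fun x => a * f x ord0 i + g x ord0 i)); last first.
    by apply/funext => x; rewrite !mxE.
  by apply: measurable_funD => //; apply: measurable_funM.
apply/L2P => //; split=> //.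
have fg := integrable_dot mA Lf Lg.
rewrite (_ : _ \o _ = (fun x => ((a ^+ 2)%:E * (EFin \o (fun x => dot (f x) (f x))) x)%E)
    \+ ((fun x => ((2 * a)%:E * (EFin \o (fun x => dot (f x) (g x))) x)%E)
        \+ (EFin \o (fun x => dot (g x) (g x)))))%E.
  by do 2?[apply: integrableD => //]; exact: integrableZl.
apply/funext => x /=; rewrite -!EFinM -!EFinD; congr EFin.
rewrite (_ : (a *: f + g) x = a *: f x + g x)// dot_lin !(dotC _ (a *: f x + g x)) !dot_lin.
by rewrite (dotC (g x) (f x)); ring.
Qed.

Lemma L2_0 A : measurable A -> L2 A 0.
Proof.
move=> mA; split=> [i|]; last first.
  rewrite /sqnorm integral0_eq// => x _; rewrite enorm_sqr dot0l//.
rewrite (_ : (fun _ => _) = cst 0) //; apply/funext => x; by rewrite mxE.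
Qed.

Lemma L2_semi_inner A : measurable A -> semi_inner (L2 A) (inner A).
Proof.
move=> mA; split.
- by split; [exact: L2_0|move=> a f g; exact: L2_lin].
- move=> a f g w Lf Lg Lw; rewrite /inner.
  have hf := integrable_dot mA Lf Lw; have hg := integrable_dot mA Lg Lw.
  rewrite -RintegralZl// -RintegralD//; last first.
    exact: (integrableZl mA a hf).
  by apply: eq_Rintegral => x _; rewrite -dot_lin.
- by move=> f g; apply: eq_Rintegral => x _; rewrite dotC.
- by move=> f _; apply: Rintegral_ge0 => x _; exact: dot_ge0.
Qed.

Lemma sqnormE A f : measurable A -> L2 A f -> sqnorm A f = (inner A f f)%:E.
Proof.
move=> mA Lf; have := integrable_dot mA Lf Lf; rewrite /inner/Rintegral => h.
rewrite fineK; last exact: integrable_fin_num.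
by apply: eq_integral => x _; rewrite enorm_sqr.
Qed.

Lemma l2normE A f : measurable A -> L2 A f -> l2norm A f = (ipnorm (inner A) f)%:E.
Proof.
move=> mA Lf; rewrite /l2norm sqnormE// poweR_EFin powR12_sqrt//.
exact: ip_ge0 (L2_semi_inner mA) _ Lf.
Qed.

Lemma L2_subset A B f : measurable A -> measurable B -> A `<=` B -> L2 B f -> L2 A f.
Proof.
move=> mA mB AB /(L2P _ mB)[mf hf]; apply/(L2P _ mA); split.
  by move=> i; exact: measurable_funS (mf i).
exact: integrableS hf.
Qed.

Lemma inner_ae_eq D f g w : measurable D -> L2 D f -> L2 D g -> L2 D w ->
  ae_eq_on D f g -> inner D f w = inner D g w.
Proof.
move=> mD Lf Lg Lw fg; congr fine; apply: ae_eq_integral => //.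
- exact: measurable_int (integrable_dot mD Lf Lw).
- exact: measurable_int (integrable_dot mD Lg Lw).
- by apply: filterS fg => x /[apply] ->.
Qed.

Lemma inner_supported A B f w : measurable A -> measurable B ->
  (forall x, A x -> ~ B x -> w x = 0) -> inner A f w = inner (B `&` A) f w.
Proof.
move=> mA mB w0; rewrite /inner setIC Rintegral_mkcondr; apply: eq_Rintegral => x.
rewrite inE => Ax; rewrite patchE; case: ifPn => //; rewrite notin_setE => Bx.
by rewrite w0// dotC dot0l.
Qed.

(** A nonzero value would persist on an open set, which has positive measure. U is separate from A
    because A will be a union of closed cells cut by the domain, on which f is continuous only in
    the relative sense. *)
Lemma inner0_continuous A U f x : measurable A -> open U -> U `<=` A ->
  L2 A f -> inner A f f = 0 -> (forall y, U y -> {for y, continuous f}) ->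
  U x -> f x = 0.
Proof.
move=> mA oU UA Lf f0 cf Ux; apply: contrapT => fx0.
have : nbhs x (f @^-1` (~` [set 0]) `&` U).
  apply: filterI; last exact: open_nbhs_nbhs.
  apply: cf => //; apply: open_nbhs_nbhs; split=> //.
  apply: closed_openC; apply: accessible_closed_set1; exact/hausdorff_accessible/norm_hausdorff.
rewrite nbhsE => -[V [oV Vx] VU].
have := lebesgue_rV_open_gt0 oV (ex_intro _ x Vx).
rewrite lt_neqAle eq_sym => /andP[/eqP + _]; apply.
have : {ae mu, forall x, A x -> dot (f x) (f x) = 0}.
  have : (\int[mu]_(x in A) `|(EFin \o (fun x => dot (f x) (f x))) x|)%E = 0%E.
    rewrite -[RHS](congr1 EFin f0) -sqnormE//; apply: eq_integral => y _ /=.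
    by rewrite enorm_sqr ger0_norm// dot_ge0.
  move/(ae_eq_integral_abs _ mA) => h.
  have /h : measurable_fun A (EFin \o (fun x => dot (f x) (f x))).
    exact: measurable_int (integrable_dot mA Lf Lf).
  by apply: filterS => y /= + Ay => /(_ Ay) [].
move=> [N [mN N0 hN]]; apply/eqP; rewrite eq_le measure_ge0 andbT -N0.
apply: le_measure; rewrite ?inE//; first exact: open_measurable_rV.
move=> y Vy; apply: hN => /=; have [fy0 Uy] := VU _ Vy.
by move=> /(_ (UA _ Uy))/dot_eq0.
Qed.

End L2_space.

(** * Sobolev norms and the linear structure of their spaces *)

Section sobolev.
Context {R : realType} {d : nat}.
Notation E := 'rV[R]_d.
Notation mu := (@lebesgue_rV R d).
Implicit Types (a : R) (f g : E -> E) (phi : E -> R).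

Lemma continuous_bounded_on (D : set E) phi : bounded_set D -> continuous phi ->
  exists M : R, forall x, D x -> `|phi x| <= M.
Proof.
move=> [M [_ /(_ (M + 1))]]; rewrite ltrDl ltr01 => /(_ isT) DM cphi.
pose K := [set x : E | `|x| <= M + 1].
have cK : compact K.
  apply: bounded_closed_compact.
    by exists (M + 1); split=> [|y My x /= /le_trans]; [exact: num_real|apply; exact: ltW].
  rewrite (_ : K = (fun x : E => `|x|) @^-1` [set y | y <= M + 1])//.
  apply: closed_comp => [x _|]; first exact: norm_continuous.
  exact: closed_le.
have /compact_bounded[N [_ /(_ (N + 1))]] : compact (phi @` K).
  by apply: continuous_compact => //; exact: continuous_subspaceT.
rewrite ltrDl ltr01 => /(_ isT) h; exists (N + 1) => x /DM Kx.
by apply: h; exists x.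
Qed.

Variable D : set E.
Hypotheses (oD : open D) (bD : bounded_set D).
Let mD : measurable D. Proof. exact: open_measurable_rV. Qed.

Lemma L2_mul_integrable f phi (j : 'I_d) : L2 D f -> continuous phi ->
  mu.-integrable D (EFin \o (fun x => f x ord0 j * phi x)).
Proof.
move=> /(L2P _ mD)[mf hf] cphi; have [M hM] := continuous_bounded_on bD cphi.
have Dfin := lebesgue_rV_bounded mD bD.
(* A crude form of Young's inequality: the constant [M ^+ 2] is integrable on a bounded set, so the
   product is dominated by an integrable function. *)
have aux (s t q N : R) : 0 <= s -> 0 <= t -> t <= N -> s ^+ 2 <= q -> s * t <= q + N ^+ 2.
  by move=> s0 t0 tN sq; have : 0 <= (s - t) ^+ 2 := sqr_ge0 _; nra.
have hc : mu.-integrable D (EFin \o cst (M ^+ 2)).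
  apply/integrableP; split; first exact/measurable_EFinP.
  under eq_integral do rewrite /= ger0_norm ?sqr_ge0//.
  by rewrite integral_cst// lte_mul_pinfty// lee_fin sqr_ge0.
apply: le_integrable (integrableD mD hf hc) => //.
  apply/measurable_EFinP; apply: measurable_funM => //.
  exact: measurable_funS (continuous_measurable_fun_rV cphi).
move=> x /hM hx /=; rewrite lee_fin.
have h : (f x ord0 j) ^+ 2 <= dot (f x) (f x).
  rewrite /dot (bigD1 j)//= expr2 lerDl; apply: sumr_ge0 => i _.
  by rewrite -expr2 sqr_ge0.
rewrite [leRHS]ger0_norm ?addr_ge0 ?sqr_ge0 ?dot_ge0// normrM.
apply: aux => //.
by rewrite real_normK// num_real.
Qed.

Lemma test_function_continuous phi (s : seq 'I_d) :
  test_function D phi -> continuous (pderivs s phi).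
Proof. by move=> [h _] x; have [] := h (size s) s (leqnn _) x I. Qed.

Lemma weak_derivatives_lin k f g a (F G : @multi_index d k -> E -> E) :
  weak_derivatives D f F -> weak_derivatives D g G ->
  weak_derivatives D (a *: f + g) (fun i => a *: F i + G i).
Proof.
move=> [F0 hF] [G0 hG]; split; first by rewrite F0 G0.
have L0 : (order_mi ([ffun=> ord0] : @multi_index d k) <= k)%N.
  by rewrite /order_mi big1// => i _; rewrite ffunE.
have Lf : L2 D f by rewrite -F0; exact: (hF _ L0).1.
have Lg : L2 D g by rewrite -G0; exact: (hG _ L0).1.
move=> i ik; have [LF wF] := hF i ik; have [LG wG] := hG i ik.
split; first exact: L2_lin.
move=> phi hphi j.
have lin f1 f2 (psi : E -> R) : L2 D f1 -> L2 D f2 -> continuous psi ->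
    \int[mu]_(x in D) ((a *: f1 + f2) x ord0 j * psi x) =
    a * \int[mu]_(x in D) (f1 x ord0 j * psi x) + \int[mu]_(x in D) (f2 x ord0 j * psi x).
  move=> L1 L2' cpsi; have I1 := L2_mul_integrable j L1 cpsi.
  have I2 := L2_mul_integrable j L2' cpsi.
  rewrite -RintegralZl// -RintegralD//; last first.
    exact: (integrableZl mD a I1).
  by apply: eq_Rintegral => x _; rewrite !mxE mulrDl mulrA.
have cphi : continuous phi := test_function_continuous (s := [::]) hphi.
rewrite lin//; last exact: test_function_continuous.
by rewrite wF// wG// lin// mulrDr mulrCA.
Qed.

Definition sobolev_sum k (G : @multi_index d k -> E -> E) :=
  \sum_(i : @multi_index d k | (order_mi i <= k)%N) inner D (G i) (G i).

(** [hnorm] is an infimum over families of weak derivatives. A strict upper bound is the form from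
    which one such family can be extracted and, conversely, which one family establishes. *)
Lemma hnorm_ltP k f (x : \bar R) : (hnorm k D f < x)%E <->
  exists2 G, weak_derivatives D f G & ((Num.sqrt (@sobolev_sum k G))%:E < x)%E.
Proof.
have e G : weak_derivatives D f G ->
    ((\sum_(a : @multi_index d k | (order_mi a <= k)%N) sqnorm D (G a)) `^ 2^-1)%E
    = (Num.sqrt (sobolev_sum G))%:E.
  move=> [_ hG].
  rewrite (eq_bigr (fun i => (inner D (G i) (G i))%:E)); last first.
    by move=> i /hG[Li _]; rewrite sqnormE.
  rewrite sumEFin poweR_EFin powR12_sqrt//; apply: sumr_ge0 => i /hG[Li _].
  exact: ip_ge0 (L2_semi_inner mD) _ Li.
split.
  by move=> /ereal_inf_lt[_ [G /= wG <-]]; rewrite e// => Gx; exists G.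
move=> [G wG]; apply: le_lt_trans; apply: ereal_inf_lbound; exists G => //.
exact: e.
Qed.

Lemma Hs_L2 k f : Hs k D f -> L2 D f.
Proof.
move=> /hnorm_ltP[G [<- hG] _]; apply: (hG _ _).1.
by rewrite /order_mi big1// => i _; rewrite ffunE.
Qed.

Lemma l2norm_le_hnorm k f : (l2norm D f <= hnorm k D f)%E.
Proof.
rewrite leNgt; apply/negP => /hnorm_ltP[G wG].
have L0 : (order_mi ([ffun=> ord0] : @multi_index d k) <= k)%N.
  by rewrite /order_mi big1// => i _; rewrite ffunE.
have [<- hG] := wG; have [L _] := hG _ L0.
rewrite l2normE// lte_fin ltNge => /negP; apply.
apply: ler_wsqrtr; rewrite /sobolev_sum (bigD1 [ffun=> ord0])//= lerDl.
apply: sumr_ge0 => i /andP[/hG[Li _] _].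
exact: ip_ge0 (L2_semi_inner mD) _ Li.
Qed.

Lemma hnorm_ge0 k f : (0 <= hnorm k D f)%E.
Proof. by rewrite (le_trans _ (l2norm_le_hnorm k f))// poweR_ge0. Qed.

(** The factor 2 replaces Minkowski's inequality for the sum over multi-indices: the squares are
    compared term by term. This suffices to show that norms are finite, bounded or small. *)
Lemma hnorm_lin k f g a (x y : R) : (hnorm k D f < x%:E)%E -> (hnorm k D g < y%:E)%E ->
  (hnorm k D (a *: f + g)%R < (2 * (`|a| * x + y))%:E)%E.
Proof.
move=> /hnorm_ltP[F wF]; rewrite lte_fin => hF /hnorm_ltP[G wG]; rewrite lte_fin => hG.
apply/hnorm_ltP; exists (fun i => a *: F i + G i).
  exact: weak_derivatives_lin.
have hip := L2_semi_inner mD.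
have ge0 (K : @multi_index d k -> E -> E) f1 : weak_derivatives D f1 K -> 0 <= sobolev_sum K.
  by move=> [_ hK]; apply: sumr_ge0 => i /hK[Li _]; exact: ip_ge0 hip _ Li.
have aux (p q r b : R) : 0 <= p -> p <= b * q + r ->
    p ^+ 2 <= 2 * (b ^+ 2 * q ^+ 2) + 2 * r ^+ 2.
  move=> p0 pqr; have : 0 <= (b * q - r) ^+ 2 := sqr_ge0 _.
  by have : p ^+ 2 <= (b * q + r) ^+ 2 by [apply: lerXn2r; rewrite ?nnegrE// (le_trans p0)]; nra.
have F0 := ge0 _ _ wF; have G0 := ge0 _ _ wG.
have le : sobolev_sum (fun i => a *: F i + G i) <=
    2 * (a ^+ 2 * sobolev_sum F + sobolev_sum G).
  rewrite /sobolev_sum mulrDr !mulr_sumr -big_split/=; apply: ler_sum => i ik.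
  have [Li _] := wF.2 i ik; have [Lj _] := wG.2 i ik.
  have Laf := subZ a (ip_sub hip) Li.
  have := ler_ipnormD hip Laf Lj; rewrite (ipnormZ hip)//.
  have LaD := subD (ip_sub hip) Laf Lj.
  rewrite -!(sqr_ipnorm hip)// -(real_normK (num_real a)).
  by apply: aux => //; exact: ipnorm_ge0.
rewrite lte_fin.
have sF0 := sqrtr_ge0 (sobolev_sum F); have sG0 := sqrtr_ge0 (sobolev_sum G).
apply: (@le_lt_trans _ _ (2 * (`|a| * Num.sqrt (sobolev_sum F) + Num.sqrt (sobolev_sum G)))).
  have rhs0 : 0 <= 2 * (`|a| * Num.sqrt (sobolev_sum F) + Num.sqrt (sobolev_sum G)).
    by rewrite mulr_ge0// addr_ge0// mulr_ge0.
  rewrite -[leRHS]ger0_norm// -sqrtr_sqr ler_wsqrtr// (le_trans le)//.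
  rewrite -{1}(sqr_sqrtr F0) -{1}(sqr_sqrtr G0) -(real_normK (num_real a)).
  have : 0 <= `|a| * Num.sqrt (sobolev_sum F) * Num.sqrt (sobolev_sum G) by rewrite !mulr_ge0.
  have := sqr_ge0 (`|a| * Num.sqrt (sobolev_sum F)); have := sqr_ge0 (Num.sqrt (sobolev_sum G)).
  by nra.
rewrite ltr_pM2l// ler_ltD// ler_wpM2l//; exact: ltW.
Qed.

Lemma Hs_lin k f g a : Hs k D f -> Hs k D g -> Hs k D (a *: f + g).
Proof.
rewrite /Hs => hf hg.
have := @hnorm_lin k f g a (fine (hnorm k D f) + 1) (fine (hnorm k D g) + 1).
have fin h : (hnorm k D h < +oo -> hnorm k D h < (fine (hnorm k D h) + 1)%:E)%E.
  by move=> hh; rewrite EFinD fineK ?lteDl// ge0_fin_numE ?hnorm_ge0.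
by move=> /(_ (fin _ hf) (fin _ hg))/lt_le_trans; apply; rewrite leey.
Qed.

Lemma test_function_lin a phi psi : test_function D phi -> test_function D psi ->
  test_function D (fun x => a * phi x + psi x).
Proof.
move=> [sphi [K [cK KD K0]]] [spsi [L [cL LD L0]]].
have pd s : pderivs s (fun x => a * phi x + psi x) =
    (fun x => a * pderivs s phi x + pderivs s psi x).
  elim: s => //= i s ->; apply/funext => x.
  (* Derivability of [pderivs s] comes from the smoothness of one order more than [size s]. *)
  have [_ /(_ (leqnn _) i) d1] := sphi (size s).+1 s (leqnSn _) x I.
  have [_ /(_ (leqnn _) i) d2] := spsi (size s).+1 s (leqnSn _) x I.
  have dz := derivableZ (k := a) d1.
  by rewrite (deriveD dz d2) (deriveZ a d1).
split; last first.
  exists (K `|` L); split; first exact: compactU.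
    by rewrite subUset.
  by move=> x /not_orP[/K0 -> /L0 ->]; rewrite mulr0 addr0.
move=> k s sk x _; rewrite pd.
have [c1 d1] := sphi k s sk x I; have [c2 d2] := spsi k s sk x I.
split; first by apply: continuousD => //; apply: continuousM => //; exact: cst_continuous.
move=> ks i; apply: (@derivableD _ _ _ (a \*: pderivs s phi) (pderivs s psi)).
  by apply: derivableZ; exact: d1.
exact: d2.
Qed.

Lemma H10_lin f g a : H10 D f -> H10 D g -> H10 D (a *: f + g).
Proof.
move=> [hf1 hf] [hg1 hg]; split; first exact: Hs_lin.
move=> e e0.
have a1 : 0 < 8 * (`|a| + 1) by rewrite mulr_gt0// ltr_wpDl.
(* With these two bounds [hnorm_lin] gives at most e/2, since |a| / (|a| + 1) is at most 1. *)
have [p tp hp] := hf (e / (8 * (`|a| + 1))) (divr_gt0 e0 a1).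
have [q tq hq] := hg (e / 8) (divr_gt0 e0 (ltr0Sn _ _)).
exists (a *: p + q).
  move=> i; rewrite (_ : (fun _ => _) = fun x => a * p x ord0 i + q x ord0 i).
    exact: test_function_lin.
  by apply/funext => x; rewrite !mxE.
rewrite (_ : _ - _ = a *: (f - p) + (g - q)); last by rewrite scalerBr opprD addrACA.
apply: (lt_le_trans (hnorm_lin a hp hq)); rewrite lee_fin.
rewrite (_ : 2 * _ = (2 * (`|a| / (`|a| + 1)) + 2) * (e / 8)); last first.
  by field; lra.
rewrite [leRHS](_ : e = 8 * (e / 8)); last by field.
rewrite ler_pM2r ?divr_gt0//.
suff : `|a| / (`|a| + 1) <= 1 by lra.
by rewrite ler_pdivrMr ?mul1r ?lerDl ?ltr_wpDl.
Qed.

End sobolev.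

(** * Cells, barycentric coordinates and piecewise linear functions *)

Section mesh_cells.
Context {R : realType} {d : nat}.
Notation E := 'rV[R]_d.
Notation mu := (@lebesgue_rV R d).
Variable M : mesh R d.
Notation idx := 'I_(mesh_nodes M).
Implicit Types (T : {set idx}) (l : idx -> R) (w : E -> E) (A : {set {set idx}}).

(** The vertices of T, prefixed by a coordinate 1, are linearly independent, so a matrix recovers
    the weights from the point. The coordinates are thus affine functions on the whole space, hence
    measurable. *)
Lemma barycentric_coordinates T : affinely_independent T ->
  exists g : idx -> E -> R, (forall i, measurable_fun setT (g i)) /\
    forall l, weights T l -> forall i, g i (combination l) = l i.
Proof.
move=> aff.
pose hat (x : E) : 'rV[R]_d.+1 :=
  \row_j (if unlift ord0 j is Some k then x ord0 k else 1).
pose X : 'M[R]_(mesh_nodes M, d.+1) := \matrix_(i, j) ((i \in T)%:R * hat (node i) ord0 j).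
pose I_T : 'M[R]_(mesh_nodes M) := \matrix_(i, j) ((i \in T) && (i == j))%:R.
have hatE l : (forall i, i \notin T -> l i = 0) ->
    \row_i l i *m X = \row_j (if unlift ord0 j is Some k then combination l ord0 k else \sum_i l i).
  move=> lT; apply/rowP => j; rewrite !mxE.
  have e i : (\row_i l i) ord0 i * X i j = l i * hat (node i) ord0 j.
    rewrite !mxE; case: (boolP (i \in T)) => iT; first by rewrite mul1r.
    by rewrite lT// !mul0r.
  rewrite (eq_bigr _ (fun i _ => e i)).
  case: unliftP => [k ->|->].
    rewrite /combination summxE; apply: eq_bigr => i _; rewrite !mxE.
    by rewrite liftK.
  by apply: eq_bigr => i _; rewrite !mxE unlift_none mulr1.
(* A column of the cokernel of [X^T], restricted to T, is an affine dependence of the nodes and so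
   vanishes. Hence [I_T] factors through [X^T], and the factor Y inverts X on weights supported in
   T. *)
have /mulmxKpV : (I_T <= X^T)%MS.
  rewrite submxE; have := mulmx_coker X^T; move: (cokermx X^T) => K XK.
  apply/eqP/matrixP => i k; rewrite [RHS]mxE.
  pose l j := (j \in T)%:R * K j k.
  have lT j : j \notin T -> l j = 0 by rewrite /l => /negbTE ->; rewrite mul0r.
  have l0 : \row_i l i *m X = 0.
    apply/rowP => j; rewrite !mxE.
    transitivity ((X^T *m K) j k); last by rewrite XK mxE.
    rewrite mxE; apply: eq_bigr => i' _; rewrite !mxE /l.
    by case: (i' \in T); rewrite ?mul0r ?mul1r// [LHS]mulrC.
  have := hatE l lT; rewrite l0 => /rowP h.
  have li : l i = 0.
    apply: aff => //.
      by have := h ord0; rewrite !mxE unlift_none.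
    by apply/rowP => j; have := h (lift ord0 j); rewrite !mxE liftK.
  rewrite mxE (bigD1 i)//= big1 ?addr0 => [|j ji].
    by rewrite mxE eqxx andbT.
  by rewrite mxE eq_sym (negbTE ji) andbF mul0r.
move: (I_T *m _) => Y YX.
exists (fun i x => \sum_j hat x ord0 j * Y i j); split.
  move=> i; apply: measurable_sum => j; apply: measurable_funM => //.
  under eq_fun do rewrite mxE.
  by case: unlift => [k|]; [exact: measurable_coord|exact: measurable_cst].
move=> l [_ lT l1] i.
have {}hatE : hat (combination l) = \row_i l i *m X.
  by rewrite hatE//; apply/rowP => j; rewrite !mxE; case: unlift => //; rewrite l1.
transitivity ((hat (combination l) *m Y^T) ord0 i).
  by rewrite mxE; apply: eq_bigr => j _; rewrite [Y^T _ _]mxE.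
have /(congr1 trmx) := YX; rewrite trmx_mul trmxK hatE -mulmxA => ->.
rewrite mxE (bigD1 i)//= big1 ?addr0 => [|j ji]; rewrite !mxE ?eqxx ?andbT.
  by case: (boolP (i \in T)) => iT; rewrite ?mulr1// lT// mul0r.
by rewrite eq_sym (negbTE ji) andbF mulr0.
Qed.

(** The affine coordinates exist at every point, so x belongs to the cell when they are admissible
    weights and also reproduce x; the last condition excludes points off the affine hull. *)
Lemma measurable_cell T : affinely_independent T -> measurable (cell T).
Proof.
move=> /barycentric_coordinates[g [mg gE]].
have -> : cell T = \bigcap_(i in [set: idx]) (g i @^-1` `[0, +oo[) `&`
    \bigcap_(i in [set i | i \notin T]) (g i @^-1` [set 0]) `&`
    ((fun x => \sum_i g i x) @^-1` [set 1]) `&`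
    \bigcap_(j in [set: 'I_d])
      ((fun x => \sum_i g i x * node i ord0 j - x ord0 j) @^-1` [set 0]).
  apply/seteqP; split=> x /=.
    move=> [l wl <-]; have [l0 lT l1] := wl; split; first split; first split.
    - by move=> i _ /=; rewrite in_itv/= andbT gE.
    - by move=> i iT /=; rewrite gE// lT.
    - by rewrite -[RHS]l1; apply: eq_bigr => i _; rewrite gE.
    - move=> j _ /=; apply/eqP; rewrite subr_eq0 /combination summxE; apply/eqP.
      by apply: eq_bigr => i _; rewrite -/(combination l) gE// mxE.
  move=> [[[h0 hT] h1] hx]; exists (fun i => g i x).
    split=> [i|i iT|//]; last exact: hT.
    by have := h0 i I; rewrite /= in_itv/= andbT.
  apply/rowP => j; rewrite /combination summxE.
  have /eqP := hx j I; rewrite subr_eq0 => /eqP <-.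
  by apply: eq_bigr => i _; rewrite mxE.
apply: measurableI; [apply: measurableI; [apply: measurableI|]|].
- apply: fin_bigcap_measurable => [|i _]; first exact: finite_finset.
  by rewrite -[X in measurable X]setTI; apply: mg => //; exact: measurable_itv.
- apply: fin_bigcap_measurable => [|i _]; first exact: finite_finset.
  by rewrite -[X in measurable X]setTI; apply: mg => //; exact: measurable_set1.
- rewrite -[X in measurable X]setTI.
  by apply: measurable_sum => //; exact: measurable_set1.
- apply: fin_bigcap_measurable => [|j _]; first exact: finite_finset.
  rewrite -[X in measurable X]setTI.
  apply: measurable_funB => //; last exact: measurable_coord.
  by apply: measurable_sum => i; exact: measurable_funM.
Qed.

Lemma cellsE A : cells A = \bigcup_(T in [set T | T \in A]) cell T.
Proof. by []. Qed.

Variable hA : forall T, T \in elements M -> affinely_independent T.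

Lemma measurable_cells A : A \subset elements M -> measurable (cells A).
Proof.
move=> /fintype.subsetP Ael; rewrite cellsE; apply: fin_bigcup_measurable => [|T].
  exact: finite_finset.
by move=> /Ael/hA/measurable_cell.
Qed.

Lemma measurable_fun_cells A (f : E -> R) : A \subset elements M ->
  (forall T, T \in A -> measurable_fun (cell T) f) -> measurable_fun (cells A) f.
Proof.
move=> /fintype.subsetP Ael mf _ Y mY; rewrite cellsE setI_bigcupl.
apply: fin_bigcup_measurable => [|T TA]; first exact: finite_finset.
by apply: mf => //; apply: measurable_cell; exact/hA/Ael.
Qed.

Lemma weights_le1 T l i : weights T l -> l i <= 1.
Proof.
by move=> [l0 _ <-]; rewrite (bigD1 i)//= lerDl; apply: sumr_ge0.
Qed.

Lemma piecewise_linear_L2 A (B : set E) w : A \subset elements M -> measurable B ->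
  (mu B < +oo)%E -> piecewise_linear A w -> L2 (cells A `&` B) w.
Proof.
move=> Ael mB Bfin [_ wE]; have mA := measurable_cells Ael.
have mAB := measurableI _ _ mA mB.
have mw j : measurable_fun (cells A) (fun x => w x ord0 j).
  apply: measurable_fun_cells => // T TA.
  have /hA/barycentric_coordinates[g [mg gE]] := fintype.subsetP Ael _ TA.
  apply: (@eq_measurable_fun _ _ _ _ _ (fun x => \sum_i g i x * w (node i) ord0 j)).
    move=> x; rewrite inE => -[l wl <-]; rewrite (wE T)// summxE.
    by apply: eq_bigr => i _; rewrite gE// mxE.
  by apply: measurable_sum => i; apply: measurable_funM => //; exact: measurable_funS (mg i).
apply/(L2P _ mAB); split.
  by move=> j; apply: measurable_funS (mw j).
(* Each component of a convex combination is bounded by the sum of the absolute nodal components; C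
   adds the squares of these bounds. *)
pose C := \sum_j (\sum_(i : idx) `|w (node i) ord0 j|) ^+ 2.
apply: measurable_bounded_integrable => //.
- by rewrite (le_lt_trans _ Bfin)// le_measure ?inE//; exact: subIsetr.
- by apply: measurable_dot => j; apply: measurable_funS (mw j).
- exists C; split=> [|y Cy x]; first exact: num_real.
  move=> [[T TA [l wl <-]] _] /=; apply: le_trans (ltW Cy).
  rewrite ger0_norm ?dot_ge0//; apply: ler_sum => j _.
  rewrite -expr2 -(real_normK (num_real _)) lerXn2r// ?nnegrE//.
    by rewrite sumr_ge0.
  rewrite (wE T)// summxE (le_trans (ler_norm_sum _ _ _))//.
  apply: ler_sum => i _; rewrite mxE normrM ler_piMl// ger0_norm.
    exact: weights_le1 wl.
  by case: wl.
Qed.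

Lemma piecewise_linear_sub A : subspace_pred (piecewise_linear A : (E -> E) -> Prop).
Proof.
split.
  split=> [|T _ l _]; first by apply: continuous_subspaceT => x; exact: cst_continuous.
  by rewrite big1// => i _; rewrite scaler0.
move=> a f g [cf lf] [cg lg]; split.
  move=> x; apply: continuousD; last exact: cg.
  by apply: continuousZl_tmp; exact: cf.
move=> T TA l wl; rewrite !fctE (lf T)// (lg T)// scaler_sumr -big_split/=.
by apply: eq_bigr => i _; rewrite scalerDr !scalerA mulrC.
Qed.

Lemma piecewise_linear0 A w : piecewise_linear A w ->
  (forall i T, T \in A -> i \in T -> w (node i) = 0) ->
  forall x, cells A x -> w x = 0.
Proof.
move=> [_ wE] w0 _ [T TA [l wl <-]]; rewrite (wE T)// big1// => i _.
case: (boolP (i \in T)) => iT; first by rewrite (w0 i T)// scaler0.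
by have [_ -> //] := wl; rewrite scale0r.
Qed.

(** Finitely many nodal values determine an element of V on B, so [exists_projection] applies and
    the choice made by [l2_projection] is indeed a projection. *)
Lemma is_l2_projectionP (V : (E -> E) -> Prop) A (B : set E) w :
  measurable B -> subspace_pred V -> (forall q, V q -> piecewise_linear A q) ->
  (forall q, V q -> L2 B q) ->
  (forall q x, V q -> B x -> ~ cells A x -> q x = 0) ->
  L2 B w -> is_l2_projection V B w (l2_projection V B w).
Proof.
move=> mB hV VA VL V0 Lw.
(* The functionals are the components of the nodal values, numbered through [enum_val], and 0 for
   larger indices. *)
pose l k (q : E -> E) : R := if insub k is Some kk then
  let p := enum_val (kk : 'I_#|{: idx * 'I_d}|) in q (node p.1) ord0 p.2 else 0.
have lin i a x y : V x -> V y -> l i (a *: x + y) = a * l i x + l i y.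
  by rewrite /l; case: insub => [kk|] _ _; rewrite ?mulr0 ?addr0// !mxE.
have null q : V q -> (forall i, (i < #|{: idx * 'I_d}|)%N -> l i q = 0) -> inner B q q = 0.
  move=> Vq lq.
  have q0 i T : T \in A -> i \in T -> q (node i) = 0.
    move=> _ _; apply/rowP => j; rewrite mxE.
    have := lq (enum_rank (i, j)) (ltn_ord _).
    by rewrite /l (valK (enum_rank (i, j))) enum_rankK.
  transitivity (inner B 0 q); last by rewrite (ip0l (L2_semi_inner mB))//; exact: VL.
  apply: eq_Rintegral => x; rewrite inE => Bx.
  suff -> : q x = 0 by rewrite dot0l.
  have [Ax|nAx] := pselect (cells A x); last exact: V0.
  exact: piecewise_linear0 (VA _ Vq) q0 _ Ax.
have [p Vp hp] := exists_projection (L2_semi_inner mB) hV VL lin null Lw.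
by apply: (@xgetPex _ _ [set p | is_l2_projection V B w p]); exists p; split.
Qed.

(** * Nodal values, the Clement operator and the nodal basis *)

Section triangulated.
Variable D : set E.
Hypotheses (oD : open D) (Dfin : (mu D < +oo)%E).
Hypothesis hd : (0 < d)%N.
Hypothesis hM : triangulation M D.
Variable sigma : R.
Hypotheses (sigma0 : 0 < sigma) (hsigma : shape_regular M sigma).
Let mD : measurable D. Proof. exact: open_measurable_rV. Qed.

Lemma weights_conv T l l' s : 0 <= s <= 1 -> weights T l -> weights T l' ->
  weights T (fun i => (1 - s) * l i + s * l' i).
Proof.
move=> /andP[s0 s1] [l0 lT l1] [l'0 l'T l'1]; split.
- by move=> i; rewrite addr_ge0// mulr_ge0// subr_ge0.
- by move=> i iT; rewrite lT// l'T// !mulr0 addr0.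
- by rewrite big_split/= -!mulr_sumr l1 l'1 !mulr1 subrK.
Qed.

Lemma weights_node T i : i \in T -> weights T (fun j => (j == i)%:R).
Proof.
move=> iT; split=> [j|j jT|]; first exact: ler0n.
  by apply/eqP; rewrite pnatr_eq0 eqb0; apply: contraNneq jT => ->.
by rewrite (bigD1 i)//= eqxx big1 ?addr0// => j /negbTE ->.
Qed.

Lemma combination_node i : combination (fun j : idx => (j == i)%:R) = node i.
Proof.
rewrite /combination (bigD1 i)//= eqxx scale1r big1 ?addr0// => j /negbTE ->.
by rewrite scale0r.
Qed.

(** The balls of shape regularity have radius proportional to the diameter, so they are useful only
    if it is positive. An element has two distinct vertices, and equal nodes would be an affine
    dependence. *)
Lemma cell_diameter_gt0 T : T \in elements M -> 0 < cell_diameter T.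
Proof.
have [h1 _ _ _ _] := hM; move=> TM; have [cT aff] := h1 _ TM.
have /card_gt1P[i [j [iT jT ij]]] : (1 < #|T|)%N by rewrite cT ltnS.
have nij : 0 < enorm (node i - node j).
  rewrite lt_def sqrtr_ge0 andbT; apply/eqP => n0.
  have /dot_eq0 /eqP : dot (node i - node j) (node i - node j) = 0.
    by rewrite -enorm_sqr n0 expr0n.
  rewrite subr_eq0 => /eqP e.
  have := aff (fun k => (k == i)%:R - (k == j)%:R) _ _ _ i.
  rewrite eqxx (negbTE ij) subr0 => /(_ _ _ _)/eqP; rewrite oner_eq0 => h; suff: false by [].
  apply: h.
  - move=> k kT; rewrite (_ : k == i = false); last by apply: contraNF kT => /eqP ->.
    by rewrite (_ : k == j = false) ?subr0//; apply: contraNF kT => /eqP ->.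
  - by rewrite sumrB; have [_ _ ->] := weights_node iT; have [_ _ ->] := weights_node jT; rewrite subrr.
  - rewrite /combination; under eq_bigr do rewrite scalerBl.
    rewrite sumrB -/(combination _) -/(combination _) !combination_node e subrr//.
rewrite /cell_diameter; apply: (lt_le_trans nij).
rewrite (bigmaxD1 i)// le_max; apply/orP; left.
by rewrite (bigmaxD1 j)// le_max lexx.
Qed.

Lemma cell_ball T : T \in elements M ->
  exists (c : E) (s : R), 0 < s /\ ball c s `<=` cell T.
Proof.
move=> TM; have [c cT] := hsigma TM.
have r0 : 0 < sigma * cell_diameter T by rewrite mulr_gt0// cell_diameter_gt0.
set r := sigma * _ in r0 cT.
have dd : 0 < d%:R + 1 :> R by rewrite ltr_wpDl.
(* A maximum-norm ball of this radius lies in the Euclidean ball of radius r, because d / (d + 1)^2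
   < 1. *)
exists c, (r / (d%:R + 1)); split; first by rewrite divr_gt0.
have s0 : 0 < r / (d%:R + 1) by rewrite divr_gt0.
move=> x; rewrite ball_rVE//= => h; apply: cT; rewrite /eball/=.
rewrite -(ltr_pXn2r (n := 2))// ?nnegrE ?sqrtr_ge0 ?ltW// enorm_sqr.
apply: (@le_lt_trans _ _ (\sum_(i < d) (r / (d%:R + 1)) ^+ 2)).
  apply: ler_sum => i _; rewrite -expr2 !mxE -(real_normK (num_real _)) lerXn2r ?nnegrE//.
    exact: ltW.
  by rewrite distrC ltW.
rewrite sumr_const card_ord.
rewrite [ltLHS](_ : _ = r ^+ 2 * (d%:R / (d%:R + 1) ^+ 2)); last first.
  by rewrite -[LHS]mulr_natl; field; rewrite gt_eqF.
rewrite gtr_pMr ?exprn_gt0// ltr_pdivrMr ?exprn_gt0// mul1r sqrrD expr1n mulr1.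
by have := ler0n R d; nra.
Qed.

(* The values at the vertices are determined by the restriction to D, because
   each element contains a ball, and this ball meets D. *)
Lemma piecewise_linear_inner0 A w i T : A \subset elements M -> T \in A -> i \in T ->
  piecewise_linear A w -> inner (cells A `&` D) w w = 0 -> w (node i) = 0.
Proof.
move=> Ael TA iT plw w0; have [cw wE] := plw.
have TM := fintype.subsetP Ael _ TA.
have [c [s [s0 cT]]] := cell_ball TM.
have mA := measurable_cells Ael.
have cA : ball c s `<=` cells A by move=> x /cT; exists T.
have oU : open (ball c s `&` D) by apply: openI => //; exact: ball_open.
have wU y : (ball c s `&` D) y -> w y = 0.
  apply: (inner0_continuous (A := cells A `&` D)) => //.
  - exact: measurableI.
  - by apply: setSI.
  - exact: piecewise_linear_L2.
  - move=> z [cz _]; have := continuous_subspaceW cA cw.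
    rewrite continuous_open_subspace; last exact: ball_open.
    by apply; rewrite inE.
have [_ _ _ clM _] := hM.
have /clM clc : cells (elements M) c by exists T => //; apply: cT; exact: ballxx.
have [y0 [Dy cy]] : D `&` ball c s !=set0 by apply: clc; exact: nbhsx_ballx.
have [l wl ly] := cT _ cy.
(* The segment from y0 to the vertex stays in the cell and, for small t, in the open set where w
   vanishes. As w is linear in the weights and vanishes at y0, its value at [z t] is
   [t *: w (node i)]. *)
pose z (t : R) : E := (1 - t) *: y0 + t *: node i.
have : \forall t \near (0 : R), (ball c s `&` D) (z t).
  have cz : {for (0:R), continuous z}.
    apply: continuousD; apply: continuousZr_tmp; last exact: cvg_id.
    by apply: continuousB; [exact: cst_continuous|exact: cvg_id].
  apply: cz; rewrite /z subr0 scale1r scale0r addr0.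
  exact: open_nbhs_nbhs.
move=> /nbhs_ballP[e /= e0 he].
pose t := Num.min (e / 2) 1.
have t0 : 0 < t by rewrite lt_min ltr01 divr_gt0.
have t1 : t <= 1 by rewrite ge_min lexx orbT.
have /he/wU : ball 0 e t.
  rewrite /ball/= sub0r normrN gtr0_norm// (@le_lt_trans _ _ (e / 2))//.
    by rewrite ge_min lexx.
  by rewrite ltr_pdivrMr// ltr_pMr// ltr1n.
have zt : z t = combination (fun j => (1 - t) * l j + t * (j == i)%:R).
  rewrite /z -ly -(combination_node i) /combination !scaler_sumr -big_split/=.
  by apply: eq_bigr => j _; rewrite [RHS]scalerDl !scalerA.
rewrite zt (wE T)//; last first.
  by apply: weights_conv => //; [rewrite ltW|exact: weights_node].
have : w (combination l) = 0 by rewrite ly; apply: wU.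
rewrite (wE T)// => wl0.
under eq_bigr do rewrite scalerDl -!scalerA.
rewrite big_split/= -!scaler_sumr wl0 scaler0 add0r.
rewrite (bigD1 i)//= eqxx scale1r big1 ?addr0; last by move=> j /negbTE ->; rewrite scale0r.
by move=> /eqP; rewrite scaler_eq0 gt_eqF//= => /eqP.
Qed.

Lemma star_elements (i : idx) : star i \subset elements M.
Proof. by apply/fintype.subsetP => T; rewrite inE => /andP[]. Qed.

(** The three projections are related only up to a null function, so additivity is claimed for the
    nodal value alone: by [piecewise_linear_inner0] a null piecewise linear function vanishes at
    [node i]. *)
Lemma clement_nodeB (i : idx) w1 w2 : L2 D w1 -> L2 D w2 ->
  clement_node D i (w1 - w2) (node i) = clement_node D i w1 (node i) - clement_node D i w2 (node i).
Proof.
move=> L1 L2'.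
have Ael := star_elements i; have mA := measurable_cells Ael.
set B := cells (star i) `&` D; have mB : measurable B by exact: measurableI.
have BD : B `<=` D by exact: subIsetr.
have Bfin : (mu B < +oo)%E by rewrite (le_lt_trans _ Dfin)// le_measure ?inE.
have hB := L2_semi_inner mB.
have spec w : L2 D w -> is_l2_projection (piecewise_linear (star i)) B w (clement_node D i w).
  move=> Lw; apply: (is_l2_projectionP (A := star i) mB (piecewise_linear_sub _)) => //.
  - by move=> q; exact: piecewise_linear_L2.
  - by move=> q x _ [].
  - exact: L2_subset Lw.
have L12 : L2 D (w1 - w2) by exact: subB (ip_sub (L2_semi_inner mD)) L1 L2'.
have [V1 h1] := spec _ L1; have [V2 h2] := spec _ L2'; have [V12 h12] := spec _ L12.
have hV := piecewise_linear_sub (star i).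
have LB w : piecewise_linear (star i) w -> L2 B w by exact: piecewise_linear_L2.
have LS w : L2 D w -> L2 B w by exact: L2_subset.
have := projectionB hB hV LB (LS _ L1) (LS _ L2') V1 V2 V12 h1 h2 h12.
have := subB hV V12 (subB hV V1 V2).
move: (clement_node D i w1) (clement_node D i w2) (clement_node D i (w1 - w2)) => p1 p2 p Vq q0.
have [_ _ /(_ i)[T TM iT] _ _] := hM.
have /(piecewise_linear_inner0 Ael) : T \in star i by rewrite inE TM.
move=> /(_ _ _ iT Vq q0)/eqP; rewrite !fctE subr_eq0 => /eqP.
exact.
Qed.

Lemma clementB w1 w2 : L2 D w1 -> L2 D w2 ->
  clement M D (w1 - w2) = clement M D w1 - clement M D w2.
Proof.
move=> L1 L2'; apply/funext => x; rewrite !fctE /clement -sumrB.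
by apply: eq_bigr => i _; rewrite clement_nodeB// scalerBr.
Qed.

(** A point may lie in several elements, and [nodal_basis] picks one. Conformity places the point in
    the cell of the common vertices, whose weights are admissible for both elements, and uniqueness
    in each identifies the coordinates. *)
Lemma nodal_basisE T (g : idx -> E -> R) x i : T \in elements M ->
  (forall l, weights T l -> forall i, g i (combination l) = l i) ->
  cell T x -> nodal_basis i x = g i x.
Proof.
move=> TM gE Tx; have [l0 wl0 lx0] := Tx.
have [h1 h2 _ _ _] := hM.
rewrite /nodal_basis.
have /xgetPex : exists l, [set l | combination l = x /\
    exists2 T, T \in elements M & weights T l] l.
  by exists l0; split=> //; exists T.
move=> /(_ (fun=> 0)); set l := xget _ _ => -[lx [T' T'M wl]].
have : (cell T `&` cell T') x by split=> //; exists l.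
rewrite h2// => -[l'' [p q r] lx''].
have w1 : weights T l''.
  by split=> // j jT; apply: q; rewrite inE (negbTE jT).
have w2 : weights T' l''.
  by split=> // j jT; apply: q; rewrite inE (negbTE jT) andbF.
have [g' [_ gE']] := barycentric_coordinates (h1 _ T'M).2.
by rewrite -(gE' _ wl) lx -lx'' gE'// gE.
Qed.

Lemma nodal_basis_out x (i : idx) : ~ cells (elements M) x -> nodal_basis i x = 0.
Proof.
move=> nx; rewrite /nodal_basis xgetPN// => l [lx [T TM wl]].
by apply: nx; exists T => //; exists l.
Qed.

Lemma measurable_nodal_basis (i : idx) : measurable_fun setT (nodal_basis (M := M) i).
Proof.
have [h1 _ _ _ _] := hM.
have mC := measurable_cells (subxx (elements M)).
rewrite -(setUv (cells (elements M))); apply/measurable_funU => //.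
  exact: measurableC.
split; last first.
  apply: (@eq_measurable_fun _ _ _ _ _ (cst (0 : R))); last exact: measurable_cst.
  by move=> x; rewrite inE => /= nx; rewrite nodal_basis_out.
apply: measurable_fun_cells => // T TM.
have [g [mg gE]] := barycentric_coordinates (h1 _ TM).2.
apply: (@eq_measurable_fun _ _ _ _ _ (g i)); last exact: measurable_funS (mg i).
by move=> x; rewrite inE => Tx; rewrite (nodal_basisE _ TM gE).
Qed.

Lemma L2_clement C w : clement_estimate M D C -> L2 D w -> L2 D (clement M D w).
Proof.
move=> [hC _] Lw; split.
  move=> j; have -> : (fun x => clement M D w x ord0 j) =
      (fun x => \sum_(i : idx) nodal_basis i x * clement_node D i w (node i) ord0 j).
    by apply/funext => x; rewrite /clement summxE; apply: eq_bigr => i _; rewrite mxE.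
  apply: measurable_sum => i; apply: measurable_funM; last exact: measurable_cst.
  exact: measurable_funS (measurable_nodal_basis i).
have h : (l2norm D (clement M D w) < +oo)%E.
  by rewrite (le_lt_trans (hC w Lw))// l2normE// -EFinM ltry.
rewrite ltey; apply: contraTneq h => e.
by rewrite /l2norm e poweRyr ?ltxx// invr_eq0 pnatr_eq0.
Qed.

End triangulated.

End mesh_cells.

(** * The finite element space and its projection *)

Section finite_element_space.
Context {R : realType} {d : nat}.
Notation E := 'rV[R]_d.
Notation mu := (@lebesgue_rV R d).
Variables (M : mesh R d) (D : set E).
Hypotheses (oD : open D) (bD : bounded_set D).

(** Zero is obtained as the difference of an element with itself, hence the assumption; the finite
    element approximation supplies the element. *)
Lemma Vh_sub : (exists q, Vh M D q) -> subspace_pred (Vh M D).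
Proof.
have lin a f g : Vh M D f -> Vh M D g -> Vh M D (a *: f + g).
  move=> [pf f0 hf] [pg g0 hg]; split.
  - exact: subDZ (piecewise_linear_sub (elements M)) _ _ _ pf pg.
  - by move=> x nx; rewrite !fctE f0// g0// scaler0 addr0.
  - exact: H10_lin.
move=> [q Vq]; split; last exact: lin.
by have := lin (-1) _ _ Vq Vq; rewrite scaleN1r addNr.
Qed.

Lemma Vh_L2 q : Vh M D q -> L2 D q.
Proof. by move=> [_ _ [/(Hs_L2 oD)]]. Qed.

Lemma Vh_projectionP w : (exists q, Vh M D q) -> L2 D w ->
  is_l2_projection (Vh M D) D w (l2_projection (Vh M D) D w).
Proof.
move=> /Vh_sub hV; apply: (is_l2_projectionP (A := elements M)) => //.
- exact: open_measurable_rV.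
- by move=> q [].
- exact: Vh_L2.
- by move=> q x [_ q0 _] _; exact: q0.
Qed.

End finite_element_space.

(** * Curves of functions: bounds, mean values, Lipschitz continuity *)

Section curves.
Context {R : realType} {d : nat}.
Notation E := 'rV[R]_d.
Notation mu := (@lebesgue_rV R d).
Variables (D : set E) (T : R).
Hypotheses (oD : open D) (bD : bounded_set D).
Let mD : measurable D. Proof. exact: open_measurable_rV. Qed.
Let hip : semi_inner (L2 D) (inner D) := L2_semi_inner mD.
Notation nrm := (ipnorm (inner D)).
Implicit Types (u du : R -> E -> E) (w : E -> E).

(** Compactness in its near-covering form: m runs along the filter at infinity, so bounds valid
    locally hold for all t once m is large. *)
Lemma locally_bounded_itv (f : R -> \bar R) :
  (forall t, `[0, T]%classic t ->
    exists2 e, 0 < e & exists m : R, forall s, `[0, T]%classic s -> `|s - t| < e -> (f s <= m%:E)%E) ->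
  exists m : R, forall t, `[0, T]%classic t -> (f t <= m%:E)%E.
Proof.
move=> h.
have /compact_near_coveringP/near_covering_withinP : compact `[0, T]%classic.
  exact: segment_compact.
move=> /(_ R (pinfty_nbhs R) (fun m s => (f s <= m%:E)%E)) [].
  move=> t tT; have [e e0 [m hm]] := h t tT.
  exists (ball t e, [set x | m <= x]); first split=> /=.
  - exact: nbhsx_ballx.
  - by exists m; split; [exact: num_real|move=> x /ltW].
  move=> [s x] /= [st mx] sT; apply: le_trans (hm s sT _) _; last by rewrite lee_fin.
  by move: st; rewrite /ball/= distrC.
by move=> m [_ hm]; exists (m + 1); apply: hm; rewrite ltrDl.
Qed.

Lemma within_near_itv (t : R) (P : set R) :
  (\forall s \near within `[0, T]%classic (nbhs t), P s) ->
  exists2 e, 0 < e & forall s, `[0, T]%classic s -> `|s - t| < e -> P s.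
Proof.
move=> /nbhs_ballP[e /= e0 he]; exists e => // s sT st; apply: he => //.
by rewrite /ball/= distrC.
Qed.

Lemma within_near_itv' (t : R) (P : set R) :
  (\forall s \near within `[0, T]%classic t^', P s) ->
  exists2 e, 0 < e & forall s, `[0, T]%classic s -> s != t -> `|s - t| < e -> P s.
Proof.
move=> /nbhs_ballP[e /= e0 he]; exists e => // s sT snt st; apply: he => //.
by rewrite /ball/= distrC.
Qed.

Lemma cvg0_lt (F : set_system R) (f : R -> \bar R) (e : R) : 0 < e ->
  f s @[s --> F] --> 0%E -> \forall s \near F, (f s < e%:E)%E.
Proof.
move=> e0 h; apply: (h [set x | (x < e%:E)%E]).
apply: open_nbhs_nbhs; split; last by rewrite /= lte_fin.
exact: open_ereal_lt_ereal.
Qed.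

Lemma curve_continuous_bounded k u : curve_continuous (hnorm k D) T u ->
  (forall t, `[0, T]%classic t -> Hs k D (u t)) ->
  exists m : R, forall t, `[0, T]%classic t -> (hnorm k D (u t) <= m%:E)%E.
Proof.
move=> cu Hu; apply: locally_bounded_itv => t tT.
have [e e0 he] := within_near_itv (cvg0_lt ltr01 (cu t tT)).
exists e => //; exists (2 * (`|1| * 1 + (fine (hnorm k D (u t)) + 1))) => s sT st.
rewrite -(subrK (u t) (u s)) -[u s - u t]scale1r; apply/ltW/hnorm_lin => //.
  exact: he.
by rewrite EFinD fineK ?lteDl// ge0_fin_numE ?hnorm_ge0//; exact: Hu.
Qed.

(** A difference quotient within 1 of the derivative already bounds the curve near each time. *)
Lemma curve_derivative_bounded k u du : curve_derivative (hnorm k D) T u du ->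
  (forall t, `[0, T]%classic t -> Hs k D (u t)) ->
  (forall t, `[0, T]%classic t -> Hs k D (du t)) ->
  exists m : R, forall t, `[0, T]%classic t -> (hnorm k D (u t) <= m%:E)%E.
Proof.
have fin f : Hs k D f -> (hnorm k D f < (fine (hnorm k D f) + 1)%:E)%E.
  by move=> hf; rewrite EFinD fineK ?lteDl// ge0_fin_numE ?hnorm_ge0.
move=> cu Hu Hdu; apply: locally_bounded_itv => t tT.
have [e e0 he] := within_near_itv' (cvg0_lt ltr01 (cu t tT)).
set a := fine (hnorm k D (u t)) + 1; set b := fine (hnorm k D (du t)) + 1.
have a0 : 0 < a by rewrite ltr_wpDl// fine_ge0// hnorm_ge0.
have b0 : 0 < b by rewrite ltr_wpDl// fine_ge0// hnorm_ge0.
exists (Num.min e 1); first by rewrite lt_min e0 ltr01.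
(* Two applications of [hnorm_lin] with |s - t| < 1: the inner one bounds [(s - t) *: du t + u t] by
   [2 * (b + a)], and the leading 1 bounds the error of the quotient. *)
exists (2 * (1 + (2 * (b + a)))) => s sT; rewrite lt_min => /andP[st st1].
have [->|snt] := eqVneq s t.
  rewrite ltW// (lt_le_trans (fin _ (Hu t tT)))// lee_fin -/a.
  by lra.
rewrite [u s](_ : _ = (s - t) *: ((s - t)^-1 *: (u s - u t) - du t) + ((s - t) *: du t + u t)); last first.
  by rewrite scalerBr scalerA divff ?subr_eq0// scale1r addrA subrK subrK.
have hd : (hnorm k D ((s - t) *: du t + u t)%R < (2 * (`|s - t| * b + a))%:E)%E.
  by apply: hnorm_lin => //; apply: fin; [exact: Hdu|exact: Hu].
apply: le_trans (ltW (hnorm_lin _ _ _ (he s sT snt st) hd)) _ => //.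
rewrite lee_fin ler_pM2l// lerD// ?mulr1 ?(ltW st1)// ler_pM2l// lerD2r.
by rewrite ler_piMl// ltW.
Qed.

Lemma ipnorm_le_hnorm k f (m : R) : L2 D f -> (hnorm k D f <= m%:E)%E -> nrm f <= m.
Proof.
move=> Lf h; rewrite -lee_fin -(l2normE mD Lf).
exact: le_trans (l2norm_le_hnorm oD k f) h.
Qed.

Variables (u du : R -> E -> E) (k : nat).
Hypothesis Lu : forall t, `[0, T]%classic t -> L2 D (u t).
Hypothesis Ldu : forall t, `[0, T]%classic t -> L2 D (du t).
Hypothesis hdu : curve_derivative (hnorm k D) T u du.

Lemma inner_slope w t (e : R) : L2 D w -> `[0, T]%classic t -> 0 < e ->
  exists2 r, 0 < r & forall s, `[0, T]%classic s -> s != t -> `|s - t| < r ->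
    `|(s - t)^-1 * (inner D (u s) w - inner D (u t) w) - inner D (du t) w| < e.
Proof.
move=> Lw tT e0.
have c0 : 0 < e / (nrm w + 1) by rewrite divr_gt0// ltr_wpDl// ipnorm_ge0.
have [r r0 hr] := within_near_itv' (cvg0_lt c0 (hdu tT)).
exists r => // s sT snt st.
have Ls := Lu sT; have Lt := Lu tT; have Ld := Ldu tT.
have Lst := subB (ip_sub hip) Ls Lt.
have Lq := subZ (s - t)^-1 (ip_sub hip) Lst.
rewrite -(ipBl hip)// -(ipZl hip)// -(ipBl hip)//.
apply: (le_lt_trans (ip_CS hip _ Lw)); first exact: subB (ip_sub hip) Lq Ld.
have h := ipnorm_le_hnorm (subB (ip_sub hip) Lq Ld) (ltW (hr s sT snt st)).
apply: (@le_lt_trans _ _ (e / (nrm w + 1) * nrm w)).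
  by rewrite ler_wpM2r ?ipnorm_ge0.
rewrite -mulrA gtr_pMr// mulrC ltr_pdivrMr ?mul1r ?ltrDl//.
by rewrite ltr_wpDl// ipnorm_ge0.
Qed.

(** Pairing with a fixed w gives a real function, to which the mean value theorem applies. The point
    c depends on w, which is harmless because w will be the single function tested in the step. *)
Lemma inner_mean_value w (a b : R) : L2 D w -> 0 <= a -> a < b -> b <= T ->
  exists2 c, a < c < b & inner D (u b - u a) w = (b - a) * inner D (du c) w.
Proof.
move=> Lw a0 ab bT.
have sub t : t \in `[a, b] -> `[0, T]%classic t.
  rewrite !in_itv/= => /andP[ta tb]; apply/andP; split; first exact: le_trans ta.
  exact: le_trans bT.
pose f t := inner D (u t) w.
have dif x : x \in `]a, b[ -> is_derive x 1 f (inner D (du x) w).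
  move=> xab; have xT : `[0, T]%classic x by apply: sub; exact: subset_itv_oo_cc.
  have cf : h^-1 *: (f (h *: 1 + x) - f x) @[h --> (0:R)^'] --> inner D (du x) w.
    apply/cvgrPdist_lt => e e0; have [r r0 hr] := inner_slope Lw xT e0.
    have : \forall y \near x, y \in `]a, b[ by exact: near_in_itvoo.
    move=> /nbhs_ballP[r' /= r'0 hr'].
    apply/nbhs_ballP; exists (Num.min r r'); first by rewrite /= lt_min r0.
    move=> h; rewrite /ball/= sub0r normrN lt_min => /andP[hr1 hr2] h0.
    have := hr (h *: 1 + x) _ _ _.
    rewrite addrK [h *: 1]mulr1 distrC => -> //.
    - by apply: sub; apply: subset_itv_oo_cc; apply: hr'; rewrite /ball/= opprD addrCA subrr addr0 normrN.
    - by rewrite -subr_eq0 addrK.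
  split; first by apply/cvg_ex; exists (inner D (du x) w).
  exact: cvg_lim cf.
have cont : {within `[a, b], continuous f}.
  apply/subspace_continuousP => x xab; have xT := sub x xab.
  apply/cvgrPdist_lt => e e0; have [r r0 hr] := inner_slope Lw xT ltr01.
  (* A difference quotient within 1 of the derivative is smaller than c in absolute value, so
     distance e / c suffices for e. *)
  set c := `|inner D (du x) w| + 1.
  have c0 : 0 < c by rewrite ltr_wpDl.
  apply/nbhs_ballP; exists (Num.min r (e / c)); first by rewrite /= lt_min r0 divr_gt0.
  move=> s; rewrite /ball/= lt_min => /andP[sr se] sab.
  have [->|snx] := eqVneq s x; first by rewrite subrr normr0.
  have := hr s (sub _ sab) snx; rewrite distrC => /(_ sr) h.
  have sx0 : s - x != 0 by rewrite subr_eq0.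
  rewrite distrC (_ : f s - f x = (s - x) * ((s - x)^-1 * (f s - f x))); last by rewrite mulVKf.
  rewrite normrM; apply: (@lt_le_trans _ _ (e / c * c)); last by rewrite divfK ?gt_eqF.
  apply: ltr_pM => //; first by rewrite distrC.
  rewrite -(subrK (inner D (du x) w) (_ * _)) (le_lt_trans (ler_normD _ _))//.
  by rewrite /c addrC ltrD2l.
have [c cab] := MVT ab dif cont.
rewrite /f => h; exists c; first by move: cab; rewrite in_itv.
rewrite mulrC -h (ipBl hip)//; apply: Lu; apply: sub; rewrite in_itv/= lexx ltW//.
Qed.

(** Tested with the increment itself, the mean value theorem gives its squared norm as [b - a] times
    a pairing with a derivative, and one factor of the norm cancels. *)
Lemma curve_lipschitz (K a b : R) : (forall t, `[0, T]%classic t -> nrm (du t) <= K) ->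
  0 <= a -> a <= b -> b <= T -> nrm (u b - u a) <= K * (b - a).
Proof.
move=> hK a0; rewrite le_eqVlt => /predU1P[<- _|ab bT].
  by rewrite !subrr mulr0 /ipnorm (ip0l hip) ?sqrtr0//; exact: L2_0.
have aT : `[0, T]%classic a by rewrite /= in_itv/= a0 (le_trans (ltW ab)).
have bT' : `[0, T]%classic b by rewrite /= in_itv/= bT (le_trans a0 (ltW ab)).
have Lab := subB (ip_sub hip) (Lu bT') (Lu aT).
have [c /andP[ac cb] e] := inner_mean_value Lab a0 ab bT.
have cT : `[0, T]%classic c by rewrite /= in_itv/= (le_trans a0 (ltW ac)) (le_trans (ltW cb)).
have K0 : 0 <= K by rewrite (le_trans _ (hK _ cT))// ipnorm_ge0.
apply: (ler_ip_ipnorm hip Lab); first by rewrite mulr_ge0// subr_ge0 ltW.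
rewrite e mulrAC mulrC ler_pM2r ?subr_gt0//.
apply: le_trans (ler_norm _) _; apply: le_trans (ip_CS hip (Ldu cT) Lab) _.
by rewrite ler_wpM2r ?ipnorm_ge0// hK.
Qed.

End curves.

(** The sum [U k + V k + 3 * del] grows at most by the factor [1 + dt * (1 + 2 * A)] per step. As
    [V k.+1] occurs in the bound on [U k.+1], the increment of V enters with weight [1 + dt <= 2];
    this yields [2 * A], and [3 * del] as del from U plus twice del from V. *)
Lemma discrete_gronwall {R : realType} (U V : nat -> R) (N : nat) (A del dt T : R) :
  0 <= A -> 0 <= del -> 0 <= dt <= 1 -> N%:R * dt <= T ->
  (forall k, 0 <= U k /\ 0 <= V k) -> U 0%N = 0 -> V 0%N = 0 ->
  (forall k, (k < N)%N -> U k.+1 <= U k + dt * (V k.+1 + del)) ->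
  (forall k, (k < N)%N -> V k.+1 <= V k + dt * (A * U k + del)) ->
  forall k, (k <= N)%N -> U k <= 3 * del * expR ((1 + 2 * A) * T).
Proof.
move=> A0 del0 /andP[dt0 dt1] NT UV0 U0 V0 hU hV.
set B := 1 + 2 * A; have B1 : 1 <= B by rewrite /B lerDl mulr_ge0.
have ind k : (k <= N)%N -> U k + V k + 3 * del <= (1 + dt * B) ^+ k * (3 * del).
  elim: k => [_|k IH kN]; first by rewrite U0 V0 !add0r mul1r.
  have {}IH := IH (ltnW kN).
  have h1 := hU k kN; have h2 := hV k kN; have [u0 v0] := UV0 k; have [u1 v1] := UV0 k.+1.
  rewrite exprS -mulrA; apply: (@le_trans _ _ ((1 + dt * B) * (U k + V k + 3 * del))).
    have : (1 + dt) * V k.+1 <= (1 + dt) * (V k + dt * (A * U k + del)).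
      by rewrite ler_wpM2l// addr_ge0.
    have : 0 <= (1 - dt) * (dt * (A * U k + del)).
      by rewrite !mulr_ge0 ?subr_ge0 ?addr_ge0 ?mulr_ge0.
    have : 0 <= dt * (V k * A) by rewrite !mulr_ge0.
    have : 0 <= dt * U k by rewrite mulr_ge0.
    have : 0 <= dt * (A * del) by rewrite !mulr_ge0.
    by rewrite /B; nra.
  by rewrite ler_wpM2l// addr_ge0// mulr_ge0// (le_trans ler01).
move=> k kN; have := ind k kN; have [u0 v0] := UV0 k.
have : (1 + dt * B) ^+ k * (3 * del) <= expR (B * T) * (3 * del).
  rewrite ler_wpM2r ?mulr_ge0//.
  apply: (@le_trans _ _ (expR (dt * B) ^+ k)).
    rewrite lerXn2r ?nnegrE ?expR_ge0 ?expR_ge1Dx//.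
    by rewrite addr_ge0// mulr_ge0// (le_trans ler01).
  rewrite -expRM_natl ler_expR -mulr_natl mulrA mulrC ler_wpM2l ?(le_trans ler01)//.
  by rewrite mulr1 (le_trans _ NT)// ler_wpM2r// ler_nat.
rewrite [expR _ * _]mulrC; lra.
Qed.

(** * The discretization error at a fixed horizon *)

Section fixed_horizon.
Context {R : realType} {d : nat}.
Notation E := 'rV[R]_d.
Notation mu := (@lebesgue_rV R d).
Variables (D : set E) (tF : R).
Hypotheses (oD : open D) (bD : bounded_set D) (d0 : (0 < d)%N) (tF0 : 0 <= tF).
Let mD : measurable D. Proof. exact: open_measurable_rV. Qed.
Let hip : semi_inner (L2 D) (inner D) := L2_semi_inner mD.
Notation nrm := (ipnorm (inner D)).
Implicit Types (w f g : E -> E).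

(** Both functions have the same set of projections, so [xget] makes the same choice and the
    equality is exact. This transfers the initial values, which the solution attains only almost
    everywhere. *)
Lemma l2_projection_ae_eq (V : (E -> E) -> Prop) w w' : (forall q, V q -> L2 D q) ->
  L2 D w -> L2 D w' -> ae_eq_on D w w' -> l2_projection V D w = l2_projection V D w'.
Proof.
move=> VL Lw Lw' ww'; rewrite /l2_projection; congr xget.
apply/seteqP; split=> p [Vp hp]; split=> // q Vq; rewrite -(hp q Vq);
  have Lp := VL _ Vp; have Lq := VL _ Vq;
  by rewrite !(ipBl hip _ _ Lq)// (inner_ae_eq mD Lw Lw').
Qed.

Lemma l2norm_le_ipnorm f g (c : R) : L2 D f -> L2 D g ->
  (l2norm D f <= c%:E * l2norm D g)%E -> nrm f <= c * nrm g.
Proof. by move=> Lf Lg; rewrite !l2normE// -EFinM lee_fin. Qed.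

Lemma l2norm_hnorm_le k f g (c m : R) : L2 D f -> 0 <= c -> Hs k D g ->
  (hnorm k D g <= m%:E)%E ->
  (l2norm D f <= c%:E * hnorm k D g)%E -> nrm f <= c * m.
Proof.
move=> Lf c0 Hg gm h; rewrite -lee_fin -(l2normE mD Lf) (le_trans h)// EFinM.
by rewrite lee_wpmul2l// lee_fin.
Qed.

Lemma H2_bound_le F (c L L' m : R) f : H2_bound D F c L L' -> H2_H10 D f ->
  (hnorm 2 D f <= m%:E)%E ->
  (hnorm 2 D (F f) <= (`|c| * (`|L| * m + `|L'| * m ^+ 2))%:E)%E.
Proof.
move=> hF Hf fm; apply: le_trans (hF f Hf) _.
have := hnorm_ge0 oD 2 f; have : hnorm 2 D f \is a fin_num.
  by rewrite ge0_fin_numE ?hnorm_ge0//; case: Hf.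
move: fm; case: (hnorm 2 D f) => // x; rewrite !lee_fin => xm _ x0.
rewrite -expr2.
have m0 := le_trans x0 xm.
have sq : x ^+ 2 <= m ^+ 2 by rewrite lerXn2r.
apply: (le_trans (ler_norm _)); rewrite normrM ler_wpM2l//.
apply: (le_trans (ler_normD _ _)); rewrite !normrM !(ger0_norm x0).
by rewrite lerD// ler_wpM2l.
Qed.

Variables (F : (E -> E) -> E -> E) (L : R).
Hypothesis hL : L2_lipschitz D F L.
Variables (b u u1 u2 : R -> E -> E) (u_0 v_0 : E -> E) (m : R).
Hypotheses (hu : forall t, `[0, tF]%classic t -> [/\ H2_H10 D (u t), H2_H10 D (u1 t),
  H2_H10 D (b t), L2 D (u2 t) & Hs 2 D (F (u t))]).
Hypothesis hm : forall t, `[0, tF]%classic t -> [/\ (hnorm 2 D (u t) <= m%:E)%E,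
  (hnorm 2 D (u1 t) <= m%:E)%E, (hnorm 2 D (b t) <= m%:E)%E &
  (hnorm 2 D (F (u t)) <= m%:E)%E].
Hypothesis mean_u : forall w s t, L2 D w -> 0 <= s -> s < t -> t <= tF ->
  exists2 c, s < c < t & inner D (u t - u s) w = (t - s) * inner D (u1 c) w.
Hypothesis mean_u1 : forall w s t, L2 D w -> 0 <= s -> s < t -> t <= tF ->
  exists2 c, s < c < t & inner D (u1 t - u1 s) w = (t - s) * inner D (u2 c) w.
Hypothesis lip_u1 : forall s t, 0 <= s -> s <= t -> t <= tF -> nrm (u1 t - u1 s) <= m * (t - s).
Hypothesis lip_u2 : forall s t, 0 <= s -> s <= t -> t <= tF -> nrm (u2 t - u2 s) <= m * (t - s).
Hypothesis u_eq : forall t, `[0, tF]%classic t -> ae_eq_on D (u2 t) (F (u t) + b t).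

Variables (M : mesh R d) (sigma c3 C : R).
Hypotheses (hM : triangulation M D) (sigma0 : 0 < sigma) (hsigma : shape_regular M sigma).
Hypotheses (hc3 : interp_estimate M D c3) (hC : clement_estimate M D C).
Notation h := (mesh_size M).
Let hA T : T \in elements M -> affinely_independent T.
Proof. by case: hM => h1 _ _ _ _ /h1[]. Qed.
Let Dfin : (mu D < +oo)%E. Proof. exact: lebesgue_rV_bounded. Qed.

Lemma clement_lipschitz w w' : L2 D w -> L2 D w' ->
  nrm (clement M D (F w) - clement M D (F w')) <= `|C| * (`|L| * nrm (w - w')).
Proof.
move=> Lw Lw'; have [LFw LF] := hL Lw Lw'; have [LFw' _] := hL Lw' Lw'.
have LFF := subB (ip_sub hip) LFw LFw'; have Lww := subB (ip_sub hip) Lw Lw'.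
rewrite -(clementB hA oD Dfin d0 hM sigma0 hsigma)//.
have LC := L2_clement hA oD hM hC LFF.
apply: (le_trans (l2norm_le_ipnorm LC LFF (hC.1 _ LFF))).
rewrite (le_trans (ler_norm _))// normrM ler_wpM2l// ger0_norm ?ipnorm_ge0//.
apply: (le_trans (l2norm_le_ipnorm LFF Lww LF)).
by rewrite ler_wpM2r ?ipnorm_ge0// ler_norm.
Qed.

(* Elements of Vh vanish outside the mesh, where the Clement interpolant is not
   an approximation. *)
Lemma clement_consistency w e : Hs 2 D w -> (hnorm 2 D w <= m%:E)%E -> Vh M D e ->
  inner D (clement M D w - w) e <= `|C| * h ^+ 2 * m * nrm e.
Proof.
move=> Hw wm Ve; have Lw := Hs_L2 oD Hw; have Le := Vh_L2 oD Ve.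
have mcells := measurable_cells hA (subxx (elements M)).
set B := cells (elements M) `&` D.
have mB : measurable B by exact: measurableI.
have BD : B `<=` D by exact: subIsetr.
have [_ e0 _] := Ve.
have eB f : inner D f e = inner B f e.
  by apply: inner_supported => // x _ nx; exact: e0.
have LC := L2_clement hA oD hM hC Lw.
have hB := L2_semi_inner mB.
have LwB := L2_subset mB mD BD Lw; have LCB := L2_subset mB mD BD LC.
have LeB := L2_subset mB mD BD Le.
have -> : nrm e = ipnorm (inner B) e by rewrite /ipnorm eB.
rewrite eB (le_trans (ler_norm _))// (le_trans (ip_CS hB (subB (ip_sub hB) LCB LwB) LeB))//.
have Lcw := subB (ip_sub hB) LwB LCB.
rewrite ler_wpM2r ?ipnorm_ge0// (ipnormB hB LCB LwB) -lee_fin -(l2normE mB Lcw).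
apply: (le_trans (hC.2 w 2 (leqnn _) Hw)).
have h0 := hnorm_ge0 oD 2 w.
apply: (@le_trans _ _ ((`|C| * h ^+ 2)%:E * hnorm 2 D w)%E).
  by rewrite lee_wpmul2r// lee_fin ler_wpM2r ?sqr_ge0// ler_norm.
by rewrite [leRHS]EFinM lee_wpmul2l// lee_fin mulr_ge0// sqr_ge0.
Qed.

Lemma interp_error w : H2_H10 D w -> (hnorm 2 D w <= m%:E)%E ->
  Vh M D (interp M D w) /\ nrm (w - interp M D w) <= `|c3| * h ^+ 2 * m.
Proof.
move=> Hw wm; have [VI Iw] := hc3 Hw; split=> //; have [H2w _] := Hw.
have Lw := Hs_L2 oD H2w; have LI := Vh_L2 oD VI.
apply: (l2norm_hnorm_le (subB (ip_sub hip) Lw LI) _ H2w wm).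
  by rewrite mulr_ge0// sqr_ge0.
apply: (le_trans Iw); rewrite lee_wpmul2r ?hnorm_ge0// lee_fin.
by rewrite ler_wpM2r ?sqr_ge0// ler_norm.
Qed.

Variables (dt : R) (N : nat) (uh vh : nat -> E -> E).
Hypotheses (dt0 : 0 < dt) (dt1 : dt <= 1) (Ndt : N%:R * dt = tF).
Hypothesis hfe : clement_fe_approximation M D tF dt F b u_0 v_0 uh vh.
Notation t k := (k%:R * dt).

Let tk k : (k <= N)%N -> `[0, tF]%classic (t k).
Proof.
move=> kN; have dt0' := ltW dt0; rewrite /= in_itv/=; apply/andP; split.
  by rewrite mulr_ge0.
by rewrite -Ndt ler_wpM2r// ler_nat.
Qed.

Let tS k : t k.+1 - t k = dt.
Proof. by rewrite -mulrBl -natrB// subSnn mul1r. Qed.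

Let m0 : 0 <= m.
Proof.
have [um _ _ _] := hm (tk (leq0n N)).
by rewrite -lee_fin (le_trans _ um)// hnorm_ge0.
Qed.

Let hV : subspace_pred (Vh M D).
Proof. by apply: Vh_sub => //; case: hfe => /(_ 0%N)[? _] _ _ _; exists (uh 0%N). Qed.
Let VL q : Vh M D q -> L2 D q. Proof. exact: Vh_L2. Qed.
Let uhV k : Vh M D (uh k). Proof. by case: hfe => /(_ k)[]. Qed.
Let vhV k : Vh M D (vh k). Proof. by case: hfe => /(_ k)[]. Qed.
Let Lu k : (k <= N)%N -> L2 D (u (t k)).
Proof. by move=> /tk/hu[[/(Hs_L2 oD)]]. Qed.
Let Lu1 k : (k <= N)%N -> L2 D (u1 (t k)).
Proof. by move=> /tk/hu[_ [/(Hs_L2 oD)]]. Qed.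

Variables (pu pv : nat -> E -> E).
Hypotheses (puV : forall k, (k <= N)%N -> Vh M D (pu k))
  (puP : forall k, (k <= N)%N -> forall q, Vh M D q -> inner D (u (t k) - pu k) q = 0)
  (pvV : forall k, (k <= N)%N -> Vh M D (pv k))
  (pvP : forall k, (k <= N)%N -> forall q, Vh M D q -> inner D (u1 (t k) - pv k) q = 0).

Let eu k := nrm (uh k - pu k).
Let ev k := nrm (vh k - pv k).

Let L2B f g : L2 D f -> L2 D g -> L2 D (f - g).
Proof. exact: subB (ip_sub hip). Qed.

Let CS f e (r : R) : L2 D f -> L2 D e -> nrm f <= r -> inner D f e <= r * nrm e.
Proof.
move=> Lf Le fr; apply: (le_trans (ler_norm _)); apply: (le_trans (ip_CS hip Lf Le)).
by rewrite ler_wpM2r ?ipnorm_ge0.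
Qed.

(** The scheme moves with [vh k.+1], the exact solution with [u1 c] at an intermediate time.
    Replacing c by [t k.+1] costs [m * dt], and then [u1] may be exchanged for its projection
    because the test function lies in [Vh]. *)
Lemma position_error k : (k < N)%N -> eu k.+1 <= eu k + dt * (ev k.+1 + m * dt).
Proof.
move=> kN; have kN' := ltnW kN.
have [Vuh Vuh'] := (uhV k, uhV k.+1).
have Ve : Vh M D (uh k.+1 - pu k.+1) := subB hV Vuh' (puV kN).
have [_ ktF] := andP (tk kN'); have [k1 k1tF] := andP (tk kN).
have klt : t k < t k.+1 by rewrite ltr_pM2r// ltr_nat.
have kge0 : 0 <= t k by rewrite mulr_ge0// ltW.
have [c /andP[kc ck] ec] := mean_u (VL Ve) kge0 klt k1tF.
have cT : `[0, tF]%classic c.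
  by rewrite /= in_itv/= (le_trans kge0 (ltW kc)) (le_trans (ltW ck)).
have Lc : L2 D (u1 c) by have [_ [/(Hs_L2 oD)]] := hu cT.
have r0 : 0 <= ev k.+1 + m * dt by rewrite addr_ge0 ?ipnorm_ge0// mulr_ge0// ltW.
have Lv := VL (vhV k.+1); have L1 := Lu1 kN; have LP := VL (pvV kN).
have step := galerkin_step hip hV VL Vuh Vuh' (Lu kN') (Lu kN) (puV kN') (puV kN)
  (puP kN') (puP kN) (ltW dt0) _ _ r0.
apply: (step (inner D (vh k.+1) (uh k.+1 - pu k.+1)) (inner D (u1 c) (uh k.+1 - pu k.+1))).
- have [_ _ _ /(_ k _ ktF Ve)[+ _]] := hfe.
  rewrite (ipZl hip _ (L2B (VL Vuh') (VL Vuh)) (VL Ve)).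
  by move=> <-; rewrite mulVKf ?gt_eqF.
- by rewrite ec tS.
move: (uh k.+1 - pu k.+1) Ve => e Ve; have Le := VL Ve.
rewrite -(ipBl hip Lv Lc Le).
have -> : inner D (vh k.+1 - u1 c) e =
    inner D (vh k.+1 - pv k.+1) e + inner D (u1 (t k.+1) - u1 c) e.
  have := pvP kN Ve.
  rewrite (ipBl hip L1 LP Le) (ipBl hip Lv LP Le) (ipBl hip L1 Lc Le) (ipBl hip Lv Lc Le).
  lra.
rewrite mulrDl lerD//; first exact: (CS (L2B Lv LP) Le).
apply: (CS (L2B L1 Lc) Le); apply: (le_trans (lip_u1 _ (ltW ck) k1tF)).
  by rewrite (le_trans kge0)// ltW.
by rewrite ler_wpM2l// -[leRHS](tS k) lerD2l lerN2 ltW.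
Qed.

(** The interpolant of [u (t k)] is a competitor in [Vh] for the best approximation. *)
Lemma projection_error k : (k <= N)%N -> nrm (u (t k) - pu k) <= `|c3| * h ^+ 2 * m.
Proof.
move=> kN; have [Hu _ _ _ _] := hu (tk kN); have [um _ _ _] := hm (tk kN).
have [VIu Iu] := interp_error Hu um; apply: le_trans Iu.
exact: (projection_best hip hV VL (Lu kN) (puV kN) VIu (puP kN)).
Qed.

Lemma velocity_error k : (k < N)%N -> ev k.+1 <= ev k + dt *
  (`|C| * (`|L| * (eu k + `|c3| * h ^+ 2 * m)) + `|C| * h ^+ 2 * m
   + `|c3| * h ^+ 2 * m + m * dt).
Proof.
move=> kN; have kN' := ltnW kN; have tkT := tk kN'.
have [Vvh Vvh'] := (vhV k, vhV k.+1).
have Ve : Vh M D (vh k.+1 - pv k.+1) := subB hV Vvh' (pvV kN).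
have [_ ktF] := andP tkT; have [k1 k1tF] := andP (tk kN).
have klt : t k < t k.+1 by rewrite ltr_pM2r// ltr_nat.
have kge0 : 0 <= t k by rewrite mulr_ge0// ltW.
have [c /andP[kc ck] ec] := mean_u1 (VL Ve) kge0 klt k1tF.
have ctF : c <= tF by rewrite (le_trans (ltW ck)).
have cT : `[0, tF]%classic c by rewrite /= in_itv/= (le_trans kge0 (ltW kc)).
have L2c : L2 D (u2 c) by have [] := hu cT.
have [Hu _ Hb L2t HF] := hu tkT.
have [um _ bm Fm] := hm tkT.
have LF := Hs_L2 oD HF.
have Luk := Lu kN'; have Luh := VL (uhV k); have LPu := VL (puV kN').
have LFh : L2 D (F (uh k)) by have [] := hL Luh Luh.
have LC := L2_clement hA oD hM hC LF; have LCh := L2_clement hA oD hM hC LFh.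
have [Hb2 _] := Hb; have Lb := Hs_L2 oD Hb2.
have [VI Ib] := interp_error Hb bm; have LI := VL VI.
have r0 : 0 <= `|C| * (`|L| * (eu k + `|c3| * h ^+ 2 * m)) + `|C| * h ^+ 2 * m
   + `|c3| * h ^+ 2 * m + m * dt.
  have h2 := sqr_ge0 h; have dt0' := ltW dt0; have eu0 : 0 <= eu k := ipnorm_ge0 _ _.
  by move: (h ^+ 2) h2 => hh h2; rewrite !(addr_ge0, mulr_ge0).
have step := galerkin_step hip hV VL Vvh Vvh' (Lu1 kN') (Lu1 kN) (pvV kN') (pvV kN)
  (pvP kN') (pvP kN) (ltW dt0) _ _ r0.
have [_ _ _ /(_ k _ ktF Ve)[_]] := hfe.
rewrite (ipZl hip _ (L2B (VL Vvh') (VL Vvh)) (VL Ve)) => fe.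
rewrite tS in ec; have {}fe := congr1 (fun r => dt * r) fe.
rewrite mulVKf ?gt_eqF// in fe; apply: (step _ _ fe ec).
move: (vh k.+1 - pv k.+1) Ve => e Ve; have Le := VL Ve.
have u2e : inner D (u2 (t k)) e = inner D (F (u (t k))) e + inner D (b (t k)) e.
  have LFb := subD (ip_sub hip) LF Lb.
  by rewrite (inner_ae_eq mD L2t LFb Le (u_eq tkT)) (ipDl hip LF Lb Le).
(* The four sources of error: Lipschitz dependence of the Clement force, its consistency,
   interpolation of b, and the variation of [u2] between [t k] and c. *)
have -> : inner D (clement M D (F (uh k))) e + inner D (interp M D (b (t k))) e
      - inner D (u2 c) e =
    inner D (clement M D (F (uh k)) - clement M D (F (u (t k)))) e
    + inner D (clement M D (F (u (t k))) - F (u (t k))) e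
    + inner D (interp M D (b (t k)) - b (t k)) e + inner D (u2 (t k) - u2 c) e.
  rewrite (ipBl hip LCh LC Le) (ipBl hip LC LF Le) (ipBl hip LI Lb Le) (ipBl hip L2t L2c Le).
  rewrite u2e; generalize (inner D (clement M D (F (uh k))) e)
    (inner D (clement M D (F (u (t k)))) e) (inner D (interp M D (b (t k))) e)
    (inner D (F (u (t k))) e) (inner D (b (t k)) e) (inner D (u2 c) e).
  by move=> *; ring.
rewrite !mulrDl; apply: lerD; first apply: lerD; first apply: lerD.
- apply: (CS (L2B LCh LC) Le).
  apply: (le_trans (clement_lipschitz Luh Luk)); rewrite ler_wpM2l// ler_wpM2l//.
  (* Passing through [pu k] splits the difference of the arguments of the force into [eu k] and the
     projection error. *)
  rewrite -(subrKA (pu k)).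
  apply: (le_trans (ler_ipnormD hip (L2B Luh LPu) (L2B LPu Luk))).
  by rewrite lerD2l (ipnormB hip LPu Luk); exact: projection_error.
- exact: clement_consistency.
- by apply: (CS (L2B LI Lb) Le); rewrite (ipnormB hip LI Lb).
- apply: (CS (L2B L2t L2c) Le).
  rewrite (ipnormB hip L2t L2c) (le_trans (lip_u2 kge0 (ltW kc) ctF))//.
  by rewrite ler_wpM2l// -[leRHS](tS k) lerD2r ltW.
Qed.

(** The factor after 3, times [h ^+ 2 + dt], dominates the inhomogeneous terms of [position_error]
    and [velocity_error]; its summand 1 covers [m * dt]. The last term of the constant is the
    projection error, paid to return from [pu k] to [u (t k)]. *)
Lemma fe_error_of_projections k : (k <= N)%N -> eu 0%N = 0 -> ev 0%N = 0 -> nrm (uh k - u (t k)) <=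
  (3 * ((`|C| * `|L| * `|c3| + `|C| + `|c3| + 1) * m) * expR ((1 + 2 * (`|C| * `|L|)) * tF)
   + `|c3| * m) * (h ^+ 2 + dt).
Proof.
move=> kN eu0 ev0; set K := (_ + _ + 1) * m.
have h2 := sqr_ge0 h.
have K0 : 0 <= K by rewrite !(mulr_ge0, addr_ge0).
have mK : m <= K by rewrite /K ler_peMl// lerDr !(mulr_ge0, addr_ge0).
have dt0' := ltW dt0.
have gr : eu k <= 3 * (K * (h ^+ 2 + dt)) * expR ((1 + 2 * (`|C| * `|L|)) * tF).
  apply: (discrete_gronwall (U := eu) (V := ev) (N := N) (dt := dt)) => //.
  - by rewrite mulr_ge0// addr_ge0.
  - by rewrite dt0'.
  - by rewrite Ndt.
  - by move=> j; split; exact: ipnorm_ge0.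
  - move=> j jN; apply: (le_trans (position_error jN)); rewrite lerD2l ler_pM2l// lerD2l.
    by rewrite ler_pM// lerDr.
  - move=> j jN; apply: (le_trans (velocity_error jN)); rewrite lerD2l ler_pM2l//.
    have : 0 <= `|C| * `|L| * `|c3| * m * dt by rewrite !mulr_ge0.
    have : 0 <= `|C| * m * dt by rewrite !mulr_ge0.
    have : 0 <= `|c3| * m * dt by rewrite !mulr_ge0.
    have : 0 <= m * h ^+ 2 by rewrite mulr_ge0.
    by rewrite /K; generalize (h ^+ 2) (eu j) => h' x; lra.
have Luk := Lu kN; have LP := VL (puV kN).
rewrite -(subrKA (pu k)).
apply: (le_trans (ler_ipnormD hip (L2B (VL (uhV k)) LP) (L2B LP Luk))).
rewrite (ipnormB hip LP Luk) mulrDl lerD//.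
  by apply: (le_trans gr); rewrite le_eqVlt; apply/orP; left; apply/eqP; ring.
by apply: (le_trans (projection_error kN)); rewrite mulrAC ler_wpM2l ?mulr_ge0// lerDl.
Qed.

End fixed_horizon.

(** The order of the quantifiers matters: m is fixed by the solution, the data and the force before
    any mesh or time step, so these can be adapted to it. The Lipschitz bound in time serves the
    step extension between nodes. *)
Lemma fe_error {R : realType} {d : nat} (D : set 'rV[R]_d) (tF L c L2c L3c : R)
    (F : ('rV[R]_d -> 'rV[R]_d) -> 'rV[R]_d -> 'rV[R]_d)
    (b u : R -> 'rV[R]_d -> 'rV[R]_d) (u_0 v_0 : 'rV[R]_d -> 'rV[R]_d) :
  open D -> bounded_set D -> (0 < d)%N -> 0 <= tF ->
  L2_lipschitz D F L -> H2_bound D F c L2c L3c ->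
  (exists b1 b2, C2_curve (hnorm 2 D) tF (H2_H10 D) b b1 b2) ->
  L2 D u_0 -> L2 D v_0 -> peridynamic_solution D tF F b u_0 v_0 u ->
  exists m : R, [/\ 0 <= m, forall t, `[0, tF]%classic t -> L2 D (u t),
    forall s t, 0 <= s -> s <= t -> t <= tF ->
      ipnorm (inner D) (u t - u s) <= m * (t - s) &
    forall (M : mesh R d) (sigma c3 C dt : R) (N : nat)
        (uh vh : nat -> 'rV[R]_d -> 'rV[R]_d),
      triangulation M D -> 0 < sigma -> shape_regular M sigma ->
      interp_estimate M D c3 -> clement_estimate M D C ->
      0 < dt -> dt <= 1 -> N%:R * dt = tF ->
      clement_fe_approximation M D tF dt F b u_0 v_0 uh vh ->
      forall k, (k <= N)%N -> L2 D (uh k) /\ ipnorm (inner D) (uh k - u (k%:R * dt)) <=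
        (3 * ((`|C| * `|L| * `|c3| + `|C| + `|c3| + 1) * m)
           * expR ((1 + 2 * (`|C| * `|L|)) * tF) + `|c3| * m)
        * (mesh_size M ^+ 2 + dt)].
Proof.
move=> oD bD d0 tF0 hL hF [b1 [b2 [Hb db _ _]]] Lu_0 Lv_0.
move=> [u1 [u2 [u3 [[Hu du du1 _] [Hu1 _ du2 cu3] ueq u0 v0]]]].
have mD := open_measurable_rV oD; have hip := L2_semi_inner mD.
have Hs2 f : H2_H10 D f -> Hs 2 D f by case.
have Lf f : H2_H10 D f -> L2 D f by move=> /Hs2/(Hs_L2 oD).
have [mb hmb] := curve_derivative_bounded oD bD db
  (fun t tT => Hs2 _ (let: And3 p _ _ := Hb t tT in p))
  (fun t tT => Hs2 _ (let: And3 _ p _ := Hb t tT in p)).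
have [mu hmu] := curve_derivative_bounded oD bD du
  (fun t tT => Hs2 _ (let: And3 p _ _ := Hu t tT in p))
  (fun t tT => Hs2 _ (let: And3 _ p _ := Hu t tT in p)).
have [mu1 hmu1] := curve_derivative_bounded oD bD du1
  (fun t tT => Hs2 _ (let: And3 p _ _ := Hu1 t tT in p))
  (fun t tT => Hs2 _ (let: And3 _ p _ := Hu1 t tT in p)).
have [mu2 hmu2] := curve_derivative_bounded oD bD du2
  (fun t tT => Hs2 _ (let: And3 _ p _ := Hu1 t tT in p))
  (fun t tT => Hs2 _ (let: And3 _ _ p := Hu1 t tT in p)).
have [mu3 hmu3] := curve_continuous_bounded oD bD cu3
  (fun t tT => Hs2 _ (let: And3 _ _ p := Hu1 t tT in p)).
pose mF := `|c| * (`|L2c| * `|mu| + `|L3c| * `|mu| ^+ 2).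
(* A sum of absolute values dominates each bound, whatever its sign; [mF] is the one that [H2_bound]
   gives for the force along u. *)
pose m := `|mb| + `|mu| + `|mu1| + `|mu2| + `|mu3| + `|mF|.
have le_m (x : \bar R) (y : R) : (x <= y%:E)%E -> `|y| <= m -> (x <= m%:E)%E.
  by move=> xy ym; rewrite (le_trans xy)// lee_fin (le_trans (ler_norm _)).
have p1 := normr_ge0 mb; have p2 := normr_ge0 mu; have p3 := normr_ge0 mu1.
have p4 := normr_ge0 mu2; have p5 := normr_ge0 mu3; have p6 := normr_ge0 mF.
have m0 : 0 <= m by rewrite /m; lra.
have hb t : `[0, tF]%classic t -> (hnorm 2 D (b t) <= m%:E)%E.
  by move=> /hmb/le_m; apply; rewrite /m; lra.
have hu t : `[0, tF]%classic t -> (hnorm 2 D (u t) <= m%:E)%E.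
  by move=> /hmu/le_m; apply; rewrite /m; lra.
have hu1 t : `[0, tF]%classic t -> (hnorm 2 D (u1 t) <= m%:E)%E.
  by move=> /hmu1/le_m; apply; rewrite /m; lra.
have hu2 t : `[0, tF]%classic t -> (hnorm 2 D (u2 t) <= m%:E)%E.
  by move=> /hmu2/le_m; apply; rewrite /m; lra.
have hu3 t : `[0, tF]%classic t -> (hnorm 2 D (u3 t) <= m%:E)%E.
  by move=> /hmu3/le_m; apply; rewrite /m; lra.
have hFu t : `[0, tF]%classic t -> (hnorm 2 D (F (u t)) <= m%:E)%E.
  move=> tT; have [Hut _ _] := Hu t tT.
  apply: (le_m _ mF); last by rewrite /m; lra.
  by apply: (H2_bound_le oD hF Hut); rewrite (le_trans (hmu t tT))// lee_fin ler_norm.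
have Lu t : `[0, tF]%classic t -> L2 D (u t) by move=> /Hu[/Lf].
have Lu1 t : `[0, tF]%classic t -> L2 D (u1 t) by move=> /Hu1[/Lf].
have Lu2 t : `[0, tF]%classic t -> L2 D (u2 t) by move=> /Hu1[_ /Lf].
have Lu3 t : `[0, tF]%classic t -> L2 D (u3 t) by move=> /Hu1[_ _ /Lf].
have lip v dv : (forall t, `[0, tF]%classic t -> L2 D (v t)) ->
    (forall t, `[0, tF]%classic t -> L2 D (dv t)) ->
    curve_derivative (hnorm 2 D) tF v dv ->
    (forall t, `[0, tF]%classic t -> (hnorm 2 D (dv t) <= m%:E)%E) ->
    forall s t, 0 <= s -> s <= t -> t <= tF -> ipnorm (inner D) (v t - v s) <= m * (t - s).
  move=> Lv Ldv dvv hdv s t s0 st tT.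
  apply: (curve_lipschitz oD Lv Ldv dvv _ s0 st tT) => r rT.
  exact: (ipnorm_le_hnorm oD (Ldv r rT) (hdv r rT)).
exists m; split=> //; first exact: lip Lu Lu1 du hu1.
move=> M sigma c3 C dt N uh vh hM sigma0 hsigma hc3 hC dt0 dt1 Ndt hfe k kN.
have [Vuv uh0 vh0 _] := hfe.
have exV : exists q, Vh M D q by exists (uh 0%N); case: (Vuv 0%N).
split; first exact: (Vh_L2 oD (Vuv k).1).
have tk j : (j <= N)%N -> `[0, tF]%classic (j%:R * dt).
  move=> jN; rewrite /= in_itv/=; apply/andP; split; first by rewrite mulr_ge0// ltW.
  by rewrite -Ndt ler_wpM2r ?ler_nat// ltW.
have hu_ t : `[0, tF]%classic t -> [/\ H2_H10 D (u t), H2_H10 D (u1 t),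
    H2_H10 D (b t), L2 D (u2 t) & Hs 2 D (F (u t))].
  move=> tT; have [? ? _] := Hu t tT; have [? _ _] := Hb t tT.
  by split=> //; [exact: Lu2|rewrite /Hs (le_lt_trans (hFu t tT))// ltry].
have hm_ t : `[0, tF]%classic t -> [/\ (hnorm 2 D (u t) <= m%:E)%E,
    (hnorm 2 D (u1 t) <= m%:E)%E, (hnorm 2 D (b t) <= m%:E)%E &
    (hnorm 2 D (F (u t)) <= m%:E)%E].
  by move=> tT; split; [exact: hu|exact: hu1|exact: hb|exact: hFu].
have mean v dv : (forall t, `[0, tF]%classic t -> L2 D (v t)) ->
    (forall t, `[0, tF]%classic t -> L2 D (dv t)) ->
    curve_derivative (hnorm 2 D) tF v dv ->
    forall w s t, L2 D w -> 0 <= s -> s < t -> t <= tF ->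
    exists2 c, s < c < t & inner D (v t - v s) w = (t - s) * inner D (dv c) w.
  move=> Lv Ldv dvv w s t Lw s0 st tT.
  exact: (inner_mean_value oD Lv Ldv dvv Lw s0 st tT).
have P_spec w : L2 D w -> is_l2_projection (Vh M D) D w (l2_projection (Vh M D) D w).
  exact: (Vh_projectionP oD bD exV).
have P_ae w w' : L2 D w -> L2 D w' -> ae_eq_on D w' w ->
    ipnorm (inner D) (l2_projection (Vh M D) D w - l2_projection (Vh M D) D w') = 0.
  move=> Lw Lw' ww'; rewrite (l2_projection_ae_eq oD (Vh_L2 oD) Lw' Lw ww') subrr.
  by rewrite /ipnorm (ip0l hip) ?sqrtr0//; exact: L2_0.
apply: (fe_error_of_projections oD bD d0 hL hu_ hm_ (mean _ _ Lu Lu1 du) (mean _ _ Lu1 Lu2 du1)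
  (lip _ _ Lu1 Lu2 du1 hu2) (lip _ _ Lu2 Lu3 du2 hu3) ueq hM sigma0 hsigma hc3 hC
  dt0 dt1 Ndt hfe (pu := fun k => l2_projection (Vh M D) D (u (k%:R * dt)))
  (pv := fun k => l2_projection (Vh M D) D (u1 (k%:R * dt)))) => //.
- by move=> j jN; have [] := P_spec _ (Lu _ (tk j jN)).
- by move=> j jN; have [] := P_spec _ (Lu _ (tk j jN)).
- by move=> j jN; have [] := P_spec _ (Lu1 _ (tk j jN)).
- by move=> j jN; have [] := P_spec _ (Lu1 _ (tk j jN)).
- rewrite uh0 mul0r; apply: P_ae => //; rewrite -(mul0r dt).
  exact: Lu (tk 0%N (leq0n N)).
- rewrite vh0 mul0r; apply: P_ae => //; rewrite -(mul0r dt).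
  exact: Lu1 (tk 0%N (leq0n N)).
Qed.

(** * Step extension in time and choice of the parameters *)

Lemma step_extensionE {R : realType} (X : Type) (N : nat) (dt tF t : R) (f : nat -> X) :
  0 < dt -> N%:R * dt = tF -> 0 <= t -> t <= tF ->
  exists k, [/\ (k <= N)%N, t <= k%:R * dt, k%:R * dt - t <= dt & step_extension dt f t = f k].
Proof.
move=> dt0 Ndt t0 ttF; rewrite /step_extension.
have q0 : 0 <= t / dt by rewrite divr_ge0// ltW.
have qN : t / dt <= N%:R by rewrite ler_pdivrMr// Ndt.
have : (0 <= Num.ceil (t / dt))%R by rewrite ceil_ge0// (lt_le_trans _ q0)// ltrN10.
(* As [N%:R * dt] is exactly tF, the node to the right of t still lies in the time interval. *)
have : (Num.ceil (t / dt) <= N%:Z)%R by rewrite ceil_le_int.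
have := gt_pred_ceil (t / dt); have := ceil_ge (t / dt).
case: (Num.ceil (t / dt)) => // k h1 h2 kN _; exists k; split=> //.
- by rewrite -ler_pdivrMr.
- move: h2; rewrite intrB ltr_pdivlMr// mulrBl => h2; rewrite lerBlDr.
  by rewrite -lerBlDl ltW// (le_lt_trans _ h2)// mul1r lerD2l.
Qed.

Theorem theorem6p1 (R : realType) (d : nat) (hd : d = 2%N \/ d = 3%N)
  (* domain, final time and data *)
  (D : set 'rV[R]_d) (hD : bounded_C1_domain D)
  (tF : R) (htF : 0 < tF)
  (u_0 v_0 : 'rV[R]_d -> 'rV[R]_d) (hu_0 : H2_H10 D u_0) (hv_0 : H2_H10 D v_0)
  (b : R -> 'rV[R]_d -> 'rV[R]_d)
  (hb : exists b1 b2, C2_curve (hnorm 2 D) tF (H2_H10 D) b b1 b2)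
  (* peridynamic force *)
  (J psi : R -> R) (hJ : @influence_function R d J) (hpsi : potential psi)
  (omega : R -> 'rV[R]_d -> R)
  (homega : forall eps, 0 < eps -> cutoff D eps (omega eps))
  (L_1 L_2 L_3 : R)
  (hL_1 : forall eps, 0 < eps ->
     L2_lipschitz D (force J psi D (omega eps) eps) (L_1 / eps ^+ 2))
  (hL23 : forall eps, 0 < eps ->
     H2_bound D (force J psi D (omega eps) eps) (eps `^ (- (5 / 2))) L_2 L_3)
  (* peridynamic solutions *)
  (u : R -> R -> 'rV[R]_d -> 'rV[R]_d)
  (hu : forall eps, 0 < eps ->
     peridynamic_solution D tF (force J psi D (omega eps) eps) b u_0 v_0 (u eps))
  (hbound : exists C : R, forall eps t, 0 < eps -> `[0, tF]%classic t ->
     {ae (@lebesgue_rV R d), forall x, D x -> enorm (u eps t x) <= C})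
  (* limit of a subsequence *)
  (ulim : R -> 'rV[R]_d -> 'rV[R]_d)
  (hulim : (forall t, `[0, tF]%classic t -> L2 D (ulim t)) /\
     curve_continuous (l2norm D) tF ulim)
  (hlim : exists e : nat -> R, [/\ forall n, 0 < e n, e n @[n --> \oo] --> 0 &
     ereal_sup [set l2norm D (u (e n) t - ulim t) | t in `[0, tF]]
       @[n --> \oo] --> 0%E])
  (* triangulations, indexed by a set of mesh sizes accumulating at 0 *)
  (sizes : set R)
  (hsizes : forall delta, 0 < delta -> exists2 h, sizes h & 0 < h < delta)
  (Th : R -> mesh R d) (sigma : R) (hsigma : 0 < sigma)
  (hTh : forall h, sizes h -> [/\ 0 < h, mesh_size (Th h) = h,
     triangulation (Th h) D & shape_regular (Th h) sigma])
  (c3 C : R)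
  (hc3 : forall h, sizes h -> interp_estimate (Th h) D c3)
  (hC : forall h, sizes h -> clement_estimate (Th h) D C)
  (* Clement nodal finite element approximations *)
  (uh vh : forall eps h dt : R, nat -> 'rV[R]_d -> 'rV[R]_d)
  (huh : forall eps h dt, 0 < eps -> sizes h -> 0 < dt ->
     clement_fe_approximation (Th h) D tF dt (force J psi D (omega eps) eps) b
       u_0 v_0 (uh eps h dt) (vh eps h dt)) :
  exists eps h dt : nat -> R,
    [/\ forall n, [/\ 0 < eps n, sizes (h n) & 0 < dt n],
        [/\ eps n @[n --> \oo] --> 0, h n @[n --> \oo] --> 0 &
            dt n @[n --> \oo] --> 0] &
        ereal_sup
          [set l2norm D (step_extension (dt n) (uh (eps n) (h n) (dt n)) t
                         - ulim t) | t in `[0, tF]]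
          @[n --> \oo] --> 0%E].
Proof.
have [oD _ _ bD _] := hD.
have d0 : (0 < d)%N by case: hd => ->.
have mD := open_measurable_rV oD; have hip := L2_semi_inner mD.
have Lu_0 : L2 D u_0 by case: hu_0 => /(Hs_L2 oD).
have Lv_0 : L2 D v_0 by case: hv_0 => /(Hs_L2 oD).
have [limL _] := hulim.
have [e [e0 e_cvg e_lim]] := hlim.
have approx n delta : 0 < delta -> exists h_dt : R * R,
    [/\ sizes h_dt.1, 0 < h_dt.1 < delta, 0 < h_dt.2 < delta &
        forall t, `[0, tF]%classic t ->
          [/\ L2 D (step_extension h_dt.2 (uh (e n) h_dt.1 h_dt.2) t), L2 D (u (e n) t) &
            ipnorm (inner D) (step_extension h_dt.2 (uh (e n) h_dt.1 h_dt.2) t - u (e n) t)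
              <= delta]].
  move=> delta0; have eps0 := e0 n.
  have [m [m0 Lu lip fe]] := fe_error oD bD d0 (ltW htF) (hL_1 _ eps0) (hL23 _ eps0) hb
    Lu_0 Lv_0 (hu _ eps0).
  set L := L_1 / e n ^+ 2 in fe.
  pose K := 3 * ((`|C| * `|L| * `|c3| + `|C| + `|c3| + 1) * m)
           * expR ((1 + 2 * (`|C| * `|L|)) * tF) + `|c3| * m.
  have K0 : 0 <= K by rewrite /K addr_ge0 ?mulr_ge0 ?expR_ge0 ?addr_ge0 ?mulr_ge0.
  have B0 : 0 < 2 * K + m + 1 by rewrite ltr_wpDl// addr_ge0// mulr_ge0.
  (* Times eta, the summands 2K and m will bound the discretization error and the change of u within
     one step. The summand 1 makes the divisor at least 1, so eta is at most delta and 1, which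
     gives [dt <= 1] and [h ^+ 2 <= h]. *)
  pose eta := Num.min delta 1 / (2 * K + m + 1).
  have min0 : 0 < Num.min delta 1 by rewrite lt_min delta0 ltr01.
  have eta0 : 0 < eta by rewrite divr_gt0.
  have etaB : (2 * K + m + 1) * eta = Num.min delta 1 by rewrite mulrC divfK ?gt_eqF.
  have eta_min : eta <= Num.min delta 1.
    by rewrite -etaB ler_peMl ?(ltW eta0)// lerDr addr_ge0// mulr_ge0.
  have eta_delta : eta <= delta by rewrite (le_trans eta_min)// ge_min lexx.
  have eta1 : eta <= 1 by rewrite (le_trans eta_min)// ge_min lexx orbT.
  have [h sh /andP[h0 heta]] := hsizes eta eta0.
  pose N := Num.bound (tF / eta).
  have N1 : tF / eta < N%:R by apply: archi_boundP; rewrite divr_ge0 ?ltW.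
  have N0 : 0 < N%:R :> R by rewrite (lt_trans _ N1)// divr_gt0.
  pose dt := tF / N%:R.
  have dt0 : 0 < dt by rewrite divr_gt0.
  have dteta : dt < eta by rewrite ltr_pdivrMr// mulrC -ltr_pdivrMr.
  have Ndt : N%:R * dt = tF by rewrite mulrC divfK ?gt_eqF.
  have dt1 : dt <= 1 by rewrite (le_trans (ltW dteta)).
  have [_ hsz htri hsr] := hTh h sh.
  have {}fe := fe _ _ _ _ _ _ _ _ htri hsigma hsr (hc3 h sh) (hC h sh) dt0 dt1 Ndt
    (huh (e n) h dt eps0 sh dt0).
  exists (h, dt); split=> //=.
  - by rewrite h0 (lt_le_trans heta).
  - by rewrite dt0 (lt_le_trans dteta).
  move=> t tT; have := tT; rewrite /= in_itv/= => /andP[t0 ttF].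
  have [k [kN tk kt ->]] := step_extensionE (uh (e n) h dt) dt0 Ndt t0 ttF.
  have [Luh errk] := fe k kN.
  have ktF : k%:R * dt <= tF by rewrite -Ndt ler_wpM2r ?ler_nat// ltW.
  have Lk : L2 D (u (e n) (k%:R * dt)) by apply: Lu; rewrite /= in_itv/= (le_trans t0 tk).
  have Lt := Lu t tT.
  (* The step function at t has its value from the node [k%:R * dt]; comparing with u at that node
     leaves the increment of u over at most one step. *)
  split=> //; rewrite -(subrKA (u (e n) (k%:R * dt))).
  apply: (le_trans (ler_ipnormD hip (subB (ip_sub hip) Luh Lk) (subB (ip_sub hip) Lk Lt))).
  apply: (@le_trans _ _ ((2 * K + m + 1) * eta)); last by rewrite etaB ge_min lexx.
  have h2 : h ^+ 2 <= eta.
    by rewrite expr2 (le_trans _ (ltW heta))// ler_piMl ?(ltW h0)// (le_trans (ltW heta)).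
  have e1 : K * (mesh_size (Th h) ^+ 2 + dt) <= 2 * K * eta.
    rewrite hsz (_ : 2 * K * eta = K * (eta + eta)); last by ring.
    by rewrite ler_wpM2l// lerD// ltW.
  have e2 : m * (k%:R * dt - t) <= m * eta.
    by rewrite ler_wpM2l// (le_trans kt)// ltW.
  apply: (le_trans (lerD (le_trans errk e1) (le_trans (lip _ _ t0 tk ktF) e2))).
  by rewrite -mulrDl ler_pM2r// lerDl.
have harm0 n : 0 < (n.+1%:R : R)^-1 by rewrite invr_gt0.
have /choice[g gP] := fun n => approx n _ (harm0 n).
exists e, (fst \o g), (snd \o g); split.
- move=> n; have [? /andP[? ?] /andP[? ?] _] := gP n; split=> //=; exact: e0.
- have sq (f : nat -> R) : (forall n, 0 < f n < n.+1%:R^-1) -> f n @[n --> \oo] --> 0.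
    move=> hf; apply: (squeeze_cvgr (f := cst 0) (h := harmonic)).
    + by apply: nearW => n; have /andP[p q] := hf n; rewrite !ltW.
    + exact: cvg_cst.
    + exact: cvg_harmonic.
  by split=> //; apply: sq => n; have [] := gP n.
pose a n := ereal_sup [set l2norm D (u (e n) t - ulim t) | t in `[0, tF]].
(* Uniformly in t, the distance to the limit is at most the discretization error plus the distance
   from [u (e n)] to the limit. *)
apply: (squeeze_cvge (f := cst 0%E) (h := fun n => ((n.+1%:R^-1)%:E + a n)%E)).
- apply: nearW => n; apply/andP; split.
    (* The time 0 shows that the supremum is over a nonempty set of nonnegative values, hence
       nonnegative. *)
    apply: (@le_trans _ _ (l2norm D (step_extension (g n).2 (uh (e n) (g n).1 (g n).2) 0 - ulim 0))).
      exact: poweR_ge0.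
    apply: ereal_sup_ubound; exists 0 => //=; rewrite in_itv/= lexx ltW//.
  apply: ub_ereal_sup => _ [t tT <-] /=.
  have [_ _ _ /(_ t tT)[Ls Lu err]] := gP n; have Ll := limL t tT.
  apply: (@le_trans _ _ ((n.+1%:R^-1)%:E + l2norm D (u (e n) t - ulim t)%R)%E); last first.
    by rewrite leeD2l//; apply: ereal_sup_ubound; exists t.
  have LB := subB (ip_sub hip).
  rewrite (l2normE mD (LB _ _ Ls Ll)) (l2normE mD (LB _ _ Lu Ll)) -EFinD lee_fin.
  rewrite -(subrKA (u (e n) t)).
  apply: (le_trans (ler_ipnormD hip (LB _ _ Ls Lu) (LB _ _ Lu Ll))).
  by rewrite lerD2r.
- exact: cvg_cst.
- rewrite -[0%E](adde0 (0%E : \bar R)); apply: cvgeD => //.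
  exact: cvge_harmonic.
Qed.
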